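(* Let $\{X_t;\,t\ge 0\}$ be a simple bilateral birth--and--death process on $\mathbf{Z}$ with birth rates $\lambda_n>0$ and death rates $\mu_n>0$ ($n\in\mathbf{Z}$). Let $\{\ldots,\nu_{-1},\nu_0,\nu_1,\ldots\}$ be a strictly monotonic sequence of positive numbers satisfying $$\nu_{n+1}\lambda_n-\nu_n(\lambda_n+\mu_n)+\nu_{n-1}\mu_n=0\qquad\text{for all } n\in\mathbf{Z}.$$ Let $\widetilde X_t$ be a bilateral birth--and--death process on $\mathbf{Z}$ with birth rates $\widetilde\lambda_n$ and death rates $\widetilde\mu_n$ given by $$\widetilde\lambda_n=\lambda_n\,\frac{\nu_{n+1}}{\nu_n},\qquad \widetilde\mu_n=\mu_n\,\frac{\nu_{n-1}}{\nu_n}\qquad(n\in\mathbf{Z}).$$ For $k\neq s$ let $\mathcal{P}_{k,s}$ and $\widetilde{\mathcal{P}}_{k,s}$ denote the ultimate crossing probabilities from $k$ to $s$ of $X_t$ and of $\widetilde X_t$, respectively. Then $$\widetilde{\mathcal{P}}_{k,s}=\frac{\nu_s}{\nu_k}\,\mathcal{P}_{k,s}\qquad(k,s\in\mathbf{Z},\ k\ne s).$$ Moreover, for all $k\neq s$, $\mathcal{P}_{k,s}$ and $\widetilde{\mathcal{P}}_{k,s}$ are never equal; in particular, they cannot both be equal to $1$.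
   Context: A bilateral birth--and--death process is a birth--and--death process $\{X_t;\,t\ge0\}$ with state space the set of all integers $\mathbf{Z}=\{\ldots,-1,0,1,\ldots\}$ whose birth rates $\lambda_n=\lim_{\delta\downarrow0}\frac1\delta\Pr\{X_{t+\delta}=n+1\mid X_t=n\}$ and death rates $\mu_n=\lim_{\delta\downarrow0}\frac1\delta\Pr\{X_{t+\delta}=n-1\mid X_t=n\}$ are positive for every $n\in\mathbf{Z}$ (so there are no absorbing or reflecting states). The process is called simple if its set of rates $\{\lambda_n,\mu_n\}$ uniquely determines the birth--and--death process; in that case, for each initial state $k\in\mathbf{Z}$, the transition probabilities $p_{k,n}(t)=\Pr\{X_t=n\mid X_0=k\}$ are the unique solution of the forward system $$\frac{d}{dt}p_{k,n}(t)=\lambda_{n-1}\,p_{k,n-1}(t)-(\lambda_n+\mu_n)\,p_{k,n}(t)+\mu_{n+1}\,p_{k,n+1}(t)\qquad(n\in\mathbf{Z})$$ with initial conditions $p_{k,n}(0)=1$ if $n=k$ and $p_{k,n}(0)=0$ if $n\ne k$. For $k\ne s$, the first--passage--time density of $X_t$ through the state $s$, conditioned on $\Pr\{X_0=k\}=1$, is $$g_{k,s}(t)=\frac{d}{dt}\Pr\big(\inf\{u>0: X_u=s\}<t\mid X_0=k\big),$$ and $\widetilde g_{k,s}(t)$ is defined in the same way with $\widetilde X$ in place of $X$. The ultimate crossing probabilities are $$\mathcal{P}_{k,s}=\int_0^\infty g_{k,s}(t)\,dt,\qquad \widetilde{\mathcal{P}}_{k,s}=\int_0^\infty\widetilde g_{k,s}(t)\,dt\qquad(k\neq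 s).$$
   Formalization: The processes are taken with right-continuous paths having left limits in Z, so that X̃ does not explode; simplicity of X alone does not ensure this, and if X̃ explodes and re-enters Z the identity fails. *)

(* Defs.v *)
From HB Require Import structures.
From mathcomp Require Import all_boot all_order all_algebra.
From mathcomp Require Import all_classical all_reals all_analysis.

Set Implicit Arguments.
Unset Strict Implicit.
Unset Printing Implicit Defensive.

Import Order.TTheory GRing.Theory Num.Theory.
Import numFieldNormedType.Exports.

Local Open Scope classical_set_scope.
Local Open Scope ring_scope.

(* [p k n t] is the probability of going from [k] to [n] in time [t]; only
   times [t >= 0] matter. The last condition says that jumps other than those
   to [n + 1] and [n - 1] have probability o(h). *)
Record bd_transition (R : realType) (lambda mu : int -> R)
    (p : int -> int -> R -> R) : Prop := BDTransition {
  bd_ge0 : forall k n (t : R), 0 <= t -> 0 <= p k n t ;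
  bd_sum1 : forall k (t : R), 0 <= t ->
    (\esum_(n in [set: int]) (p k n t)%:E = 1)%E ;
  bd_init : forall k n, p k n 0 = (n == k)%:R ;
  bd_chapman_kolmogorov : forall k n (s t : R), 0 <= s -> 0 <= t ->
    ((p k n (s + t))%:E = \esum_(m in [set: int]) (p k m s * p m n t)%:E)%E ;
  bd_birth_rate : forall n : int, p n (n + 1) h / h @[h --> 0^'+] --> lambda n ;
  bd_death_rate : forall n : int, p n (n - 1) h / h @[h --> 0^'+] --> mu n ;
  bd_exit_rate : forall n : int,
    (1 - p n n h) / h @[h --> 0^'+] --> lambda n + mu n
}.

(* Uniqueness is among all honest transition functions, including those that
   return to the integers after an explosion. *)
Definition simple_rates (R : realType) (lambda mu : int -> R) : Prop :=
  forall p q : int -> int -> R -> R,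
    bd_transition lambda mu p -> bd_transition lambda mu q ->
    forall k n t, 0 <= t -> p k n t = q k n t.

(* [P k] is the law conditioned on the initial state [k], and times are the
   [t >= 0]. *)
Definition transition_prob (R : realType) (d : measure_display)
    (T : measurableType d) (P : int -> probability T R) (X : R -> T -> int)
    (k n : int) (t : R) : R :=
  fine (P k [set w | X t w = n]).

(* In [bbd_markov], [H] lists finitely many past (time, state) pairs. The last
   two fields say that the paths are right-continuous with left limits for the
   discrete topology on the integers, hence have finitely many jumps in
   bounded time. *)
Record bilateral_birth_death (R : realType) (d : measure_display)
    (T : measurableType d) (P : int -> probability T R) (X : R -> T -> int)
    (lambda mu : int -> R) : Prop := BilateralBirthDeath {
  bbd_lambda_gt0 : forall n, 0 < lambda n ;
  bbd_mu_gt0 : forall n, 0 < mu n ;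
  bbd_measurable : forall (t : R) (n : int), 0 <= t -> measurable [set w | X t w = n] ;
  bbd_transition : bd_transition lambda mu (transition_prob P X) ;
  bbd_markov : forall (k m n : int) (H : seq (R * int)) (s t : R),
    0 <= s -> 0 <= t -> (forall a : R * int, a \in H -> 0 <= a.1 <= s) ->
    let past := [set w | forall a : R * int, a \in H -> X a.1 w = a.2] in
    P k (past `&` [set w | X s w = m] `&` [set w | X (s + t) w = n]) =
    (P k (past `&` [set w | X s w = m]) * (transition_prob P X m n t)%:E)%E ;
  bbd_right_continuous : forall (w : T) (t : R), 0 <= t ->
    \forall u \near t^'+, X u w = X t w ;
  bbd_left_limit : forall (w : T) (t : R), 0 < t ->
    exists n, \forall u \near t^'-, X u w = n
}.

(* Equal to [+oo] when [s] is never visited. *)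
Definition first_passage_time (R : realType) (T : Type) (X : R -> T -> int)
    (s : int) (w : T) : \bar R :=
  ereal_inf [set u%:E | u in [set u : R | 0 < u /\ X u w = s]].

Definition first_passage_density (R : realType) (d : measure_display)
    (T : measurableType d) (P : int -> probability T R) (X : R -> T -> int)
    (k s : int) : R -> R :=
  derive1 (fun t : R => fine (P k [set w | (first_passage_time X s w < t%:E)%E])).

Definition crossing_prob (R : realType) (d : measure_display)
    (T : measurableType d) (P : int -> probability T R) (X : R -> T -> int)
    (k s : int) : \bar R :=
  (\int[lebesgue_measure]_(t in `]0%R, +oo[%classic)
     (first_passage_density P X k s t)%:E)%E.

(* Main.v *)
(** A harmonic [nu] turns the rates of [X] into those of [X'], so for every pair of
    states the transition probabilities satisfy
    p'_{m,n}(h) = (nu_n / nu_m) p_{m,n}(h) + o(h).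
    On a grid of mesh t/N and in a finite window of states, the chance of hitting [s]
    before t is a polynomial in finitely many such numbers and the error is N o(t/N),
    which tends to 0. Paths are bounded on bounded intervals and right-continuous, so
    refining the grid and enlarging the window give
    P_k(T_s < t) <= (nu_k / nu_s) P'_k(T_s < t). The situation is symmetric under
    [nu] |-> [1 / nu], hence equality holds.

    The distribution function F_k(t) = P_k(T_s < t) solves the backward equation
    F_k' = lambda_k F_{k+1} + mu_k F_{k-1} - (lambda_k + mu_k) F_k with a continuous
    right-hand side, so the crossing probability, an integral of F_k', is
    lim F_k(t) at infinity. This limit is positive because all states communicate, and
    nu_s / nu_k <> 1. *)
Require Import Defs.
From HB Require Import structures.
From mathcomp Require Import all_boot all_order all_algebra.
From mathcomp Require Import all_classical all_reals all_analysis.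
From mathcomp Require Import measurable_realfun.
From mathcomp Require Import zify ring lra.

Set Implicit Arguments.
Unset Strict Implicit.
Unset Printing Implicit Defensive.

Import Order.TTheory GRing.Theory Num.Theory.
Import numFieldNormedType.Exports.

Local Open Scope classical_set_scope.
Local Open Scope ring_scope.

(** * Real-valued probabilities and a limit bound for events *)

Section real_probability.
Context (R : realType) (d : measure_display) (T : measurableType d).
Variable Q : probability T R.

Definition pr (A : set T) : R := fine (Q A).

Lemma prE A : measurable A -> (pr A)%:E = Q A.
Proof. by move=> mA; rewrite /pr fineK// fin_num_measure. Qed.

Lemma pr_ge0 A : 0 <= pr A.
Proof. exact: fine_ge0. Qed.

Lemma pr_mono A B : measurable A -> measurable B -> A `<=` B -> pr A <= pr B.
Proof.
by move=> mA mB AB; rewrite -lee_fin !prE// le_measure// inE.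
Qed.

Lemma pr_le1 A : measurable A -> pr A <= 1.
Proof. by move=> mA; rewrite -lee_fin prE// probability_le1. Qed.

Lemma prT : pr setT = 1.
Proof. by rewrite /pr probability_setT. Qed.

Lemma pr0 : pr set0 = 0.
Proof. by rewrite /pr measure0. Qed.

Lemma prU A B : measurable A -> measurable B -> A `&` B = set0 ->
  pr (A `|` B) = pr A + pr B.
Proof.
move=> mA mB AB0; apply: EFin_inj; rewrite EFinD !prE//; last exact: measurableU.
by rewrite measureU.
Qed.

Lemma pr_splitI A B : measurable A -> measurable B ->
  pr A = pr (A `&` B) + pr (A `&` ~` B).
Proof.
move=> mA mB; rewrite -prU.
- by rewrite -setIUr setUCr setIT.
- exact: measurableI.
- by apply: measurableI => //; exact: measurableC.
- by rewrite setIACA setICr setI0.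
Qed.

Lemma prU_le A B : measurable A -> measurable B -> pr (A `|` B) <= pr A + pr B.
Proof.
move=> mA mB; rewrite (pr_splitI (measurableU _ _ mA mB) mA).
have mC := measurableC mA.
apply: lerD; apply: pr_mono => //.
- by apply: measurableI => //; exact: measurableU.
- by apply: measurableI => //; exact: measurableU.
- by move=> w [] [].
Qed.

(** Continuity from below: the intersections of [A K N] over [N >= K] increase with [K], and each
    lies in a single [A K N] whose index may be chosen after the tolerance [e]. In the comparison,
    [K] enlarges the window and [N] refines the grid. *)
Lemma pr_liminf_le (H : set T) (A : nat -> nat -> set T) (c : R) :
  measurable H -> (forall K N, measurable (A K N)) ->
  (forall K K' N, (K <= K')%N -> A K N `<=` A K' N) ->
  H `<=` \bigcup_K \bigcap_(N in [set N | (K <= N)%N]) A K N ->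
  (forall K e, 0 < e -> exists2 N, (K <= N)%N & pr (A K N) <= c + e) ->
  pr H <= c.
Proof.
move=> mH mA Amono HA Ac.
pose B K := \bigcap_(N in [set N | (K <= N)%N]) A K N.
have mB K : measurable (B K) by apply: bigcap_measurable => // *; exists K => /=.
have mUB : measurable (\bigcup_K B K) by apply: bigcupT_measurable.
apply: le_trans (pr_mono mH mUB HA) _.
rewrite -lee_fin prE//.
have Bnd : nondecreasing_seq B.
  move=> i j ij; apply/subsetPset => w Bw N /= jN.
  by apply: (Amono i) => //; apply: Bw => /=; exact: leq_trans jN.
have := nondecreasing_cvg_mu (mu := Q) mB mUB Bnd.
move=> /cvg_lim <-//; apply: lime_le.
  apply: ereal_nondecreasing_is_cvgn => i j ij.
  by rewrite le_measure ?inE//; apply/subsetPset/Bnd.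
near=> K; rewrite /= -prE// lee_fin; apply/ler_addgt0Pr => e e0.
have [N KN AN] := Ac K e e0; apply: le_trans AN.
by apply: pr_mono => // w; apply.
Unshelve. all: by end_near. Qed.

End real_probability.

(** Dynkin's argument: the sets [G] with all three properties form a Dynkin class, and [C] is a
    pi-system. In the Markov property [c] is a transition probability. *)
Lemma measure_eq_on_sigma (R : realType) (d1 d2 : measure_display)
    (T1 : measurableType d1) (T2 : measurableType d2)
    (Q1 : probability T1 R) (Q2 : probability T2 R) (W : Type)
    (f1 : T1 -> W) (f2 : T2 -> W) (E1 : set T1) (E2 : set T2) (c : R)
    (C : set (set W)) :
  0 <= c -> measurable E1 -> measurable E2 -> setI_closed C ->
  pr Q1 E1 = c * pr Q2 E2 ->
  (forall G, C G -> [/\ measurable (f1 @^-1` G), measurable (f2 @^-1` G) &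
     pr Q1 (E1 `&` f1 @^-1` G) = c * pr Q2 (E2 `&` f2 @^-1` G)]) ->
  forall G, <<s C >> G -> [/\ measurable (f1 @^-1` G), measurable (f2 @^-1` G) &
     pr Q1 (E1 `&` f1 @^-1` G) = c * pr Q2 (E2 `&` f2 @^-1` G)].
Proof.
move=> c0 mE1 mE2 CI CT hC G; rewrite -setI_closed_g_dynkin_g_sigma_algebra//.
move: G; apply: smallest_sub; last exact: hC.
split.
- by rewrite !preimage_setT !setIT.
- move=> G [mG1 mG2 GE].
  have mC1 := measurableC mG1; have mC2 := measurableC mG2.
  rewrite 2!preimage_setC; split => //.
  have := pr_splitI Q1 mE1 mG1; have := pr_splitI Q2 mE2 mG2.
  by rewrite GE CT => ->; rewrite mulrDr => /addrI.
- move=> F tF FE; rewrite !preimage_bigcup.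
  have m1 k : measurable (f1 @^-1` F k) by case: (FE k).
  have m2 k : measurable (f2 @^-1` F k) by case: (FE k).
  have mU1 := bigcupT_measurable _ m1; have mU2 := bigcupT_measurable _ m2.
  split => //; apply: EFin_inj; rewrite EFinM !prE; [|exact: measurableI..].
  rewrite !setI_bigcupr !measure_bigcup//.
  + rewrite -nneseriesZl//; apply: eq_eseriesr => k _.
    have [_ _ FkE] := FE k; have /= := congr1 EFin FkE.
    by rewrite EFinM !prE//; exact: measurableI.
  + by move=> k _; exact: measurableI.
  + by move=> i j _ _ [w [[_ wi] [_ wj]]]; apply: tF => //; exists (f2 w).
  + by move=> k _; exact: measurableI.
  + by move=> i j _ _ [w [[_ wi] [_ wj]]]; apply: tF => //; exists (f1 w).
Qed.

(** * Path space and the sigma-algebras generated by cylinders *)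

Section path_space.
Context (R : realType).
Implicit Types (I : set R) (H : seq (R * int)) (G : set (R -> int)).

Definition cylinder H : set (R -> int) :=
  [set x | forall a, a \in H -> x a.1 = a.2].

Definition cylinders I : set_system (R -> int) :=
  [set cylinder H | H in [set H : seq (R * int) | forall a, a \in H -> I a.1]].

(** For [I] the interval from 0 to [s] this is the past up to time [s]; for the half-line it
    contains all events of the path at nonnegative times. *)
Definition path_events I : set_system (R -> int) := <<s cylinders I >>.

Lemma cylinder_nil : cylinder [::] = setT.
Proof. by rewrite -subTset => x _ a. Qed.

Lemma cylinder_cons a H :
  cylinder (a :: H) = [set x | x a.1 = a.2] `&` cylinder H.
Proof.
apply/seteqP; split => x /= => [xH|[xa xH] b].
  by split => [|b bH]; apply: xH; rewrite inE ?eqxx ?bH ?orbT.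
by rewrite inE => /predU1P[->//|]; exact: xH.
Qed.

Lemma cylinders_setI_closed I : setI_closed (cylinders I).
Proof.
move=> _ _ [H1 IH1 <-] [H2 IH2 <-]; exists (H1 ++ H2).
  by move=> a /=; rewrite mem_cat => /orP[/IH1|/IH2].
apply/seteqP; split => x /= => [xH|[x1 x2] a].
  by split => a aH; apply: xH; rewrite mem_cat aH ?orbT.
by rewrite mem_cat => /orP[/x1|/x2].
Qed.

Lemma path_events_coord I t n : I t -> path_events I [set x | x t = n].
Proof.
move=> It; apply: sub_gen_smallest; exists [:: (t, n)] => [a /=|].
  by rewrite inE => /eqP ->.
by rewrite cylinder_cons cylinder_nil setIT.
Qed.

Lemma path_eventsC I G : path_events I G -> path_events I (~` G).
Proof. by move=> IG; rewrite -setTD; apply: sigma_algebraCD. Qed.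

Lemma path_events_bigcup I (F : (set (R -> int))^nat) :
  (forall i, path_events I (F i)) -> path_events I (\bigcup_i F i).
Proof. exact: sigma_algebra_bigcup. Qed.

Lemma path_events0 I : path_events I set0.
Proof. exact: sigma_algebra0. Qed.

Lemma path_eventsT I : path_events I setT.
Proof. by rewrite -setC0; apply: path_eventsC; exact: path_events0. Qed.

Lemma path_eventsU I G1 G2 :
  path_events I G1 -> path_events I G2 -> path_events I (G1 `|` G2).
Proof.
move=> IG1 IG2; rewrite -bigcup2E; apply: path_events_bigcup => -[|[|i]] //=.
exact: path_events0.
Qed.

Lemma path_eventsI I G1 G2 :
  path_events I G1 -> path_events I G2 -> path_events I (G1 `&` G2).
Proof.
move=> IG1 IG2; rewrite -(setCK (G1 `&` G2)) setCI.
by apply: path_eventsC; apply: path_eventsU; exact: path_eventsC.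
Qed.

Lemma path_events_subset I J : I `<=` J -> path_events I `<=` path_events J.
Proof.
move=> IJ; apply: sub_smallest2r; first exact: smallest_sigma_algebra.
move=> _ [H IH <-].
by exists H => // a /IH; exact: IJ.
Qed.

End path_space.

(** * The Markov property for general past and future events *)

Section markov.
Context (R : realType) (d : measure_display) (T : measurableType d).
Context (P : int -> probability T R) (X : R -> T -> int) (lambda mu : int -> R).
Hypothesis hX : bilateral_birth_death P X lambda mu.

Local Notation p := (transition_prob P X).

(** The path after time [s] as a map into path space, so that events about paths become preimages;
    [shifted_path 0] gives the path itself. *)
Definition shifted_path (s : R) (w : T) : R -> int := fun t => X (s + t) w.

Definition at_state (t : R) (n : int) : set T := [set w | X t w = n].

Local Notation shift := shifted_path.
Local Notation ev := at_state.

Lemma at_state_measurable t n : 0 <= t -> measurable (ev t n).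
Proof. exact: (bbd_measurable hX). Qed.

Lemma shifted_path0 w : shift 0 w = X^~ w.
Proof. by apply/funext => t; rewrite /shifted_path add0r. Qed.

Lemma transition_prob_ge0 k n t : 0 <= p k n t.
Proof. exact: fine_ge0. Qed.

Lemma transition_probE k n t : p k n t = pr (P k) (ev t n).
Proof. by []. Qed.

Lemma shifted_cylinder_measurable s H : 0 <= s ->
  (forall a, a \in H -> 0 <= a.1) -> measurable (shift s @^-1` cylinder H).
Proof.
move=> s0; elim: H => [|a H IH] H0; first by rewrite cylinder_nil preimage_setT.
rewrite cylinder_cons preimage_setI; apply: measurableI.
  apply: at_state_measurable; rewrite addr_ge0// H0// mem_head//.
by apply: IH => b bH; apply: H0; rewrite inE bH orbT.
Qed.

Lemma path_event_measurable s G : 0 <= s -> path_events `[0, +oo[%classic G ->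
  measurable (shift s @^-1` G).
Proof.
move=> s0 IG.
(* Both measures are taken equal, since only the measurability part of [measure_eq_on_sigma] is
   wanted. *)
suff [] : [/\ measurable (shift s @^-1` G), measurable (shift s @^-1` G) &
    pr (P 0) (setT `&` shift s @^-1` G) =
    1 * pr (P 0) (setT `&` shift s @^-1` G)] by [].
move: G IG; apply: measure_eq_on_sigma => //.
- exact: cylinders_setI_closed.
- by rewrite mul1r.
move=> _ [H H0 <-]; rewrite mul1r.
have H0' a : a \in H -> 0 <= a.1 by move=> /H0 /=; rewrite in_itv andbT.
by split; rewrite ?mul1r//; exact: shifted_cylinder_measurable.
Qed.

Lemma past_measurable (t : R) G : 0 <= t -> path_events `[0, t]%classic G ->
  measurable (shift 0 @^-1` G).
Proof.
move=> t0 tG; apply: path_event_measurable => //.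
by apply: path_events_subset tG; exact: subset_itvl.
Qed.

(** Both sides are finite measures in [G] which agree on cylinders by [bbd_markov]; the Dynkin
    argument extends this to the whole past. *)
Lemma markov_past k m n (s t : R) G : 0 <= s -> 0 <= t ->
  path_events `[0, s]%classic G ->
  pr (P k) ((ev s m `&` ev (s + t) n) `&` shift 0 @^-1` G) =
  p m n t * pr (P k) (ev s m `&` shift 0 @^-1` G).
Proof.
move=> s0 t0 sG; have st0 := addr_ge0 s0 t0.
have m1 := at_state_measurable m s0; have m2 := at_state_measurable n st0.
have base H : (forall a, a \in H -> `[0, s]%classic a.1) ->
    pr (P k) ((ev s m `&` ev (s + t) n) `&` shift 0 @^-1` cylinder H) =
    p m n t * pr (P k) (ev s m `&` shift 0 @^-1` cylinder H).
  move=> H0; have H0' a : a \in H -> 0 <= a.1 <= s.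
    by move=> /H0 /=; rewrite in_itv.
  have HE : [set w | forall a : R * int, a \in H -> X a.1 w = a.2] =
      shift 0 @^-1` cylinder H.
    by apply/seteqP; split => w /=; rewrite shifted_path0.
  have mH : measurable (shift 0 @^-1` cylinder H).
    by apply: shifted_cylinder_measurable => // a /H0' /andP[].
  have := bbd_markov hX k m n s0 t0 H0'.
  rewrite HE /= => /(congr1 fine).
  have mHm := measurableI _ _ mH m1.
  rewrite -[X in _ = fine (X * _)%E -> _]prE// -EFinM /= mulrC => hE.
  by rewrite [in RHS]setIC -hE [in LHS]setIC setIA.
suff [] : [/\ measurable (shift 0 @^-1` G), measurable (shift 0 @^-1` G) &
    pr (P k) ((ev s m `&` ev (s + t) n) `&` shift 0 @^-1` G) =
    p m n t * pr (P k) (ev s m `&` shift 0 @^-1` G)] by [].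
move: G sG; apply: measure_eq_on_sigma.
- exact: transition_prob_ge0.
- exact: measurableI.
- exact: m1.
- exact: cylinders_setI_closed.
- have := base [::]; rewrite cylinder_nil preimage_setT !setIT; exact.
- move=> _ [H H0 <-].
  have mH : measurable (shift 0 @^-1` cylinder H).
    by apply: shifted_cylinder_measurable => // a /H0 /=; rewrite in_itv => /andP[].
  by split => //; exact: base.
Qed.

Lemma markov_transition k m n (s t : R) : 0 <= s -> 0 <= t ->
  pr (P k) (ev s m `&` ev (s + t) n) = p k m s * p m n t.
Proof.
move=> s0 t0; have := markov_past k m n s0 t0 (@path_eventsT R _).
by rewrite preimage_setT !setIT => ->; rewrite mulrC.
Qed.

(* Listing the future times in decreasing order makes the last step of a
   cylinder its head, to which [bbd_markov] applies. *)
Lemma markov_future_sorted k m s H : 0 <= s -> sorted (fun a b => b.1 <= a.1) H ->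
  (forall a, a \in H -> 0 <= a.1) ->
  pr (P k) (ev s m `&` shift s @^-1` cylinder H) =
  p k m s * pr (P m) (shift 0 @^-1` cylinder H).
Proof.
move=> s0; elim: H => [|a [|b H] IH] sH H0.
- by rewrite cylinder_nil !preimage_setT setIT prT mulr1.
- rewrite cylinder_cons cylinder_nil setIT.
  have a0 : 0 <= a.1 by apply: H0; rewrite mem_head.
  rewrite (markov_transition _ _ _ s0 a0) transition_probE.
  by congr (_ * pr _ _); apply/seteqP; split => w /=; rewrite shifted_path0.
have a0 : 0 <= a.1 by apply: H0; rewrite mem_head.
have b0 : 0 <= b.1 by apply: H0; rewrite !inE eqxx orbT.
move: sH => /= /andP[ba sH].
have bmax c : c \in b :: H -> c.1 <= b.1.
  rewrite inE => /predU1P[->//|cH].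
  have tr : transitive (fun a b : R * int => b.1 <= a.1).
    by move=> x y z /[swap]; exact: le_trans.
  by have /allP := order_path_min tr sH; exact.
have H0' c : c \in b :: H -> 0 <= c.1.
  by move=> cH; apply: H0; rewrite inE cH orbT.
have ab0 : 0 <= a.1 - b.1 by rewrite subr_ge0.
(* At time [u + b.1] both [E] and the constraints [b :: H] belong to the past and the state is
   [b.2], so [a] only contributes a factor. This is used with [E] fixing the state at time [s], and
   under [P m] with the full event at time 0. *)
have key j u E : 0 <= u -> path_events `[0, u]%classic E ->
    pr (P j) (shift 0 @^-1` E `&` shift u @^-1` cylinder (a :: b :: H)) =
    p b.2 a.2 (a.1 - b.1) *
    pr (P j) (shift 0 @^-1` E `&` shift u @^-1` cylinder (b :: H)).
  move=> u0 IE; have ub0 := addr_ge0 u0 b0.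
  pose G := E `&` cylinder [seq (u + c.1, c.2) | c <- b :: H].
  have GI : path_events `[0, (u + b.1)]%classic G.
    apply: path_eventsI.
      apply: path_events_subset IE; apply: subset_itvl.
      by rewrite bnd_simp lerDl.
    apply: sub_gen_smallest; exists [seq (u + c.1, c.2) | c <- b :: H] => //.
    move=> _ /mapP[c cH ->] /=; rewrite in_itv /= addr_ge0 ?H0'//=.
    by rewrite lerD2l bmax.
  have shG w : (shift 0 @^-1` G) w <->
      (shift 0 @^-1` E) w /\ (shift u @^-1` cylinder (b :: H)) w.
    split => -[wE wH]; split => //.
      move=> c cH; have := wH (u + c.1, c.2); rewrite shifted_path0; apply.
      by apply/mapP; exists c.
    by move=> _ /mapP[c cH ->] /=; rewrite shifted_path0; exact: wH.
  have := markov_past j b.2 a.2 ub0 ab0 GI.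
  have -> : u + b.1 + (a.1 - b.1) = u + a.1 by ring.
  rewrite [X in _ = X](_ : _ = p b.2 a.2 (a.1 - b.1) *
      pr (P j) (shift 0 @^-1` E `&` shift u @^-1` cylinder (b :: H))); last first.
    congr (_ * pr _ _); apply/seteqP; split => w.
      by move=> [_ /shG].
    by move=> wb; split; [case: wb => _; apply; rewrite mem_head | exact/shG].
  move=> <-; congr (pr _ _); apply/seteqP; split => w.
    rewrite cylinder_cons => -[wE [wa wb]]; split; last exact/shG.
    by split => //; apply: wb; rewrite mem_head.
  by move=> [[_ wa] /shG[wE wb]]; rewrite cylinder_cons.
have evE j u : ev u j = shift 0 @^-1` [set x | x u = j].
  by apply/seteqP; split => w /=; rewrite shifted_path0.
rewrite evE key//; last first.
  by apply: path_events_coord; rewrite /= in_itv /= s0 lexx.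
rewrite -evE (IH sH H0').
have := key m 0 setT (lexx 0) (@path_eventsT R _).
by rewrite preimage_setT !setTI => ->; rewrite mulrCA.
Qed.

Lemma markov_future k m s G : 0 <= s -> path_events `[0, +oo[%classic G ->
  pr (P k) (ev s m `&` shift s @^-1` G) = p k m s * pr (P m) (shift 0 @^-1` G).
Proof.
move=> s0 IG.
suff [_ _] : [/\ measurable (shift s @^-1` G), measurable (shift 0 @^-1` G) &
    pr (P k) (ev s m `&` shift s @^-1` G) =
    p k m s * pr (P m) (setT `&` shift 0 @^-1` G)].
  by rewrite setTI.
move: G IG; apply: measure_eq_on_sigma.
- exact: transition_prob_ge0.
- exact: at_state_measurable.
- exact: measurableT.
- exact: cylinders_setI_closed.
- by rewrite prT mulr1.
move=> _ [H H0 <-].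
have H0' a : a \in H -> 0 <= a.1 by move=> /H0 /=; rewrite in_itv andbT.
split; [exact: shifted_cylinder_measurable..|].
pose leT (a b : R * int) := b.1 <= a.1.
(* A cylinder depends only on the members of its list, so the times may be put in decreasing
   order. *)
have HE : cylinder H = cylinder (sort leT H).
  by apply/seteqP; split => x xH a; rewrite ?mem_sort => aH; apply: xH;
    rewrite ?mem_sort.
rewrite setTI HE markov_future_sorted//.
- by apply: sort_sorted => a b; exact: le_total.
- by move=> a; rewrite mem_sort; exact: H0'.
Qed.

End markov.

(** * Right-continuous integer paths: detecting hits, bounding values *)

Section paths.
Context (R : realType).
Implicit Types (x : R -> int) (s : int) (t : R).

Definition right_continuous_path x :=
  forall t, 0 <= t -> \forall u \near t^'+, x u = x t.

(* The time interval is open on the right to match [first_passage_time X s w < t]. *)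
Definition hit s t : set (R -> int) :=
  [set x | exists2 u, 0 <= u < t & x u = s].

(** By right-continuity a visit to [s] lasts for some time, which leaves room for a rational time or
    a grid point. *)
Lemma hit_interval x s t : right_continuous_path x -> hit s t x ->
  exists u e, [/\ 0 <= u, 0 < e, u + e <= t & forall v, u <= v < u + e -> x v = s].
Proof.
move=> xrc [u /andP[u0 ut] xu].
have [e /= e0 He] := xrc u u0.
exists u, (Num.min e (t - u)); split => //.
- by rewrite lt_min e0 subr_gt0.
- by rewrite -lerBrDl ge_min lexx orbT.
move=> v /andP[]; rewrite le_eqVlt => /predU1P[<-//|uv vu].
rewrite He//= distrC ger0_norm ?subr_ge0 ?(ltW uv)//.
by rewrite ltrBlDl (lt_le_trans vu)// lerD2l ge_min lexx.
Qed.

Lemma hit_rat x s t : right_continuous_path x -> hit s t x ->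
  exists2 q : rat, 0 <= (ratr q : R) < t & x (ratr q) = s.
Proof.
move=> xrc /(hit_interval xrc)[u [e [u0 e0 uet xs]]].
have [q] : exists q : rat, (ratr q : R) \in `]u, (u + e)[.
  by apply: rat_in_itvoo; rewrite ltrDl.
rewrite in_itv /= => /andP[uq que]; exists q.
  by rewrite (le_trans u0 (ltW uq)) (lt_le_trans que).
by apply: xs; rewrite ltW.
Qed.

(** The sampled times stop at [(j - 1) * h]; with [j = N.+1] and [h = t / N.+1%:R] they all lie
    strictly before [t]. *)
Definition grid_hit s (j : nat) (h : R) : set (R -> int) :=
  [set x | exists2 i : nat, (i < j)%N & x (i%:R * h) = s].

Lemma hit_grid_hit x s t : right_continuous_path x -> hit s t x ->
  exists K, forall N, (K <= N)%N -> grid_hit s N.+1 (t / N.+1%:R) x.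
Proof.
move=> xrc /(hit_interval xrc)[u [e [u0 e0 uet xs]]].
have t0 : 0 < t by apply: lt_le_trans uet; rewrite ltr_wpDl.
(* From this index on the mesh is smaller than the duration [e] of the visit. *)
exists (Num.truncn (t / e)) => N KN.
pose h := t / N.+1%:R.
have h0 : 0 < h by rewrite divr_gt0.
have he : h < e.
  rewrite /h ltr_pdivrMr// mulrC -ltr_pdivrMr//.
  apply: lt_le_trans (truncnS_gt _) _; rewrite ler_nat ltnS//.
(* This is the first grid point after [u], at distance at most [h < e]. *)
pose i := (Num.truncn (u / h)).+1.
have ui : u < i%:R * h by rewrite -ltr_pdivrMr// truncnS_gt.
have iu : i%:R * h <= u + h.
  rewrite /i -addn1 natrD mulrDl mul1r lerD2r -ler_pdivlMr//.
  by rewrite truncn_le divr_ge0// ltW.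
have iue : i%:R * h < u + e by apply: le_lt_trans iu _; rewrite ltrD2l.
exists i; last by apply: xs; rewrite (ltW ui).
rewrite -(@ltr_nat R) -(ltr_pM2r h0) [X in _ < X]mulrC /h divfK//.
exact: lt_le_trans iue uet.
Qed.

(** Compactness of the time interval: near each time [u] the path takes only its left limit and the
    value [x u]. *)
Lemma path_bounded x t : right_continuous_path x ->
  (forall u, 0 < u -> exists n, \forall v \near u^'-, x v = n) ->
  exists K : nat, forall u, 0 <= u <= t -> (`|x u| <= K)%N.
Proof.
move=> xrc xll.
have /compact_near_coveringP/(_ nat \oo
   (fun K (u : R) => 0 <= u -> (`|x u| <= K)%N)) := @segment_compact R 0 t.
case=> [u|K _ HK]; last first.
  exists K => u /andP[u0 ut]; apply: (HK K) => //=.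
  by rewrite in_itv /= u0 ut.
rewrite /= in_itv /= => /andP[u0 ut].
have [n Hn] : exists n : int, \forall v \near u, v < u -> 0 <= v -> x v = n.
  move: u0; rewrite le_eqVlt => /predU1P[<-|u0].
    (* At time 0 there is no left side, so any value serves. *)
    by exists 0; near=> v; rewrite leNgt => ->.
  have [n Hn] := xll u u0; exists n.
  by apply: filterS Hn.
pose M := maxn `|n|%N `|x u|%N.
have HM : \forall v \near u, 0 <= v -> (`|x v| <= M)%N.
  apply: filterS2 Hn (xrc u u0) => v Hl Hr v0.
  have [vu|uv|->] := ltgtP v u.
  - by rewrite (Hl vu v0) leq_maxl.
  - by rewrite (Hr uv) leq_maxr.
  - by rewrite leq_maxr.
exists ([set v | 0 <= v -> (`|x v| <= M)%N], [set K | (M <= K)%N]).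
  by split => //; exists M.
by move=> [v K] /= [Hv MK] v0; exact: leq_trans (Hv v0) MK.
Unshelve. all: by end_near. Qed.

End paths.

(** * Passage probabilities: measurability and first inequalities *)

Section passage.
Context (R : realType) (d : measure_display) (T : measurableType d).
Context (P : int -> probability T R) (X : R -> T -> int) (lambda mu : int -> R).
Hypothesis hX : bilateral_birth_death P X lambda mu.

Local Notation p := (transition_prob P X).
Local Notation ev := (at_state X).
Local Notation shift := (shifted_path X).

(** A visit at time 0 counts here, unlike in [first_passage_time]; by [first_passage_event] the two
    agree when [k <> s]. *)
Definition passage_prob (k s : int) (t : R) : R :=
  pr (P k) (shift 0 @^-1` hit s t).
Local Notation F := passage_prob.

Lemma shifted_path_right_continuous h w : 0 <= h -> right_continuous_path (shift h w).
Proof.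
move=> h0 t t0; have [e /= e0 He] := bbd_right_continuous hX w (addr_ge0 h0 t0).
exists e => //= u /= ute tu; apply: He => /=.
  by rewrite opprD addrACA subrr add0r.
by rewrite ltrD2l.
Qed.

Lemma shifted_path_bounded w t :
  exists K : nat, forall u, 0 <= u <= t -> (`|shift 0 w u| <= K)%N.
Proof.
apply: path_bounded; first exact: shifted_path_right_continuous.
move=> u u0; have [n Hn] := bbd_left_limit hX w u0; exists n.
by apply: filterS Hn => v; rewrite /shifted_path add0r.
Qed.

(** Right-continuity reduces the uncountable union over times to rational times. One [G] serves all
    shifts, as [markov_future] requires. *)
Lemma hit_path_event s t : exists2 G, path_events `[0, +oo[%classic G &
  forall h, 0 <= h -> shift h @^-1` hit s t = shift h @^-1` G.
Proof.
pose V (q : rat) : set (R -> int) :=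
  if 0 <= (ratr q : R) < t then [set x | x (ratr q) = s] else set0.
exists (\bigcup_i (if unpickle i is Some q then V q else set0)).
  apply: path_events_bigcup => i; case: unpickle => [q|]; last exact: path_events0.
  rewrite /V; case: ifPn => [/andP[q0 _]|_]; last exact: path_events0.
  by apply: path_events_coord; rewrite /= in_itv /= q0.
move=> h h0; apply/seteqP; split => w.
  move=> /(hit_rat (shifted_path_right_continuous w h0))[q qt ws].
  by exists (pickle q); [|rewrite pickleK /V qt].
move=> [i _]; case: unpickle => // q; rewrite /V.
by case: ifPn => // qt ws; exists (ratr q).
Qed.

Lemma hit_measurable h s t : 0 <= h -> measurable (shift h @^-1` hit s t).
Proof.
move=> h0; have [G IG ->//] := hit_path_event s t.
exact: (path_event_measurable hX h0 IG).
Qed.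

Lemma passage_prob_ge0 k s t : 0 <= F k s t.
Proof. exact: pr_ge0. Qed.

Lemma passage_prob_le1 k s t : F k s t <= 1.
Proof. by apply: pr_le1; exact: hit_measurable. Qed.

Lemma passage_prob_nondecreasing k s : {homo F k s : t u / t <= u}.
Proof.
move=> t u tu; apply: pr_mono; [exact: hit_measurable..|].
by move=> w [v /andP[v0 vt] wv]; exists v => //; rewrite v0 (lt_le_trans vt).
Qed.

Lemma markov_hit k m s h t : 0 <= h ->
  pr (P k) (ev h m `&` shift h @^-1` hit s t) = p k m h * F m s t.
Proof.
move=> h0; rewrite /passage_prob.
have [G IG hG] := hit_path_event s t.
by rewrite !hG// (markov_future hX).
Qed.

Lemma at_states_measurable t (l : seq int) : 0 <= t ->
  measurable [set w | X t w \in l].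
Proof.
move=> t0; elim: l => [|n l IH].
  by rewrite (_ : mkset _ = set0)// -subset0.
rewrite (_ : mkset _ = ev t n `|` [set w | X t w \in l]).
  by apply: measurableU => //; exact: (at_state_measurable hX).
apply/seteqP; split => w /=; rewrite inE; first by move=> /predU1P.
by move=> wnl; exact/predU1P.
Qed.

Lemma pr_sum_at_state k t (E : set T) (l : seq int) : 0 <= t -> measurable E -> uniq l ->
  \sum_(n <- l) pr (P k) (E `&` ev t n) = pr (P k) (E `&` [set w | X t w \in l]).
Proof.
move=> t0 mE; have mev n : measurable (ev t n) by exact: (at_state_measurable hX).
elim: l => [_|n l IH /= /andP[nl ul]].
  by rewrite big_nil (_ : [set w | _] = set0) ?setI0 ?pr0// -subset0.
have ml := at_states_measurable l t0.
rewrite big_cons IH// -prU; [|exact: measurableI..|].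
  rewrite -setIUr; congr (pr _ (_ `&` _)); apply/seteqP; split => w /=; rewrite inE.
    by move=> wnl; exact/predU1P.
  by move=> /predU1P.
rewrite -subset0 => w [[_ wn] [_ /=]].
by rewrite [X t w]wn (negbTE nl).
Qed.

Lemma transition_sum k t (l : seq int) : 0 <= t -> uniq l ->
  \sum_(n <- l) p k n t = pr (P k) [set w | X t w \in l].
Proof.
move=> t0 ul; rewrite -[X in pr _ X]setTI -pr_sum_at_state//.
by apply: eq_bigr => n _; rewrite setTI.
Qed.

Lemma transition_sum_le1 k t (l : seq int) : 0 <= t -> uniq l ->
  \sum_(n <- l) p k n t <= 1.
Proof.
move=> t0 ul; rewrite transition_sum//; apply: pr_le1.
exact: at_states_measurable.
Qed.

(** One way to hit before [h + t] is to let time [h] elapse and then hit within [t]; restricting the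
    intermediate state to [l] can only lose mass. *)
Lemma passage_prob_ge_step k s h t (l : seq int) : 0 <= h -> uniq l ->
  \sum_(n <- l) p k n h * F n s t <= F k s (h + t).
Proof.
move=> h0 ul; have mh := hit_measurable s t h0.
rewrite (eq_bigr (fun n => pr (P k) (shift h @^-1` hit s t `&` ev h n))); last first.
  by move=> n _; rewrite -markov_hit// setIC.
rewrite pr_sum_at_state//; apply: pr_mono.
- by apply: measurableI => //; exact: at_states_measurable.
- exact: hit_measurable.
move=> w [[u /andP[u0 ut] wu] _]; exists (h + u).
  by rewrite addr_ge0//= ltrD2l.
by rewrite shifted_path0.
Qed.

Lemma pr_init k : pr (P k) (ev 0 k) = 1.
Proof.
by have := bd_init (bbd_transition hX) k k; rewrite eqxx.
Qed.

Lemma pr_init_neq k n : n != k -> pr (P k) (ev 0 n) = 0.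
Proof.
by move=> /negbTE nk; have := bd_init (bbd_transition hX) k n; rewrite nk.
Qed.

Lemma pr_I_init k (E : set T) : measurable E ->
  pr (P k) E = pr (P k) (E `&` ev 0 k).
Proof.
move=> mE; have mk := at_state_measurable hX k (lexx 0).
rewrite (pr_splitI _ mE mk).
suff -> : pr (P k) (E `&` ~` ev 0 k) = 0 by rewrite addr0.
apply/eqP; rewrite eq_le pr_ge0 andbT.
have : pr (P k) (E `&` ~` ev 0 k) <= pr (P k) (setT `&` ~` ev 0 k).
  have mC := measurableC mk.
  by apply: pr_mono; [exact: measurableI..|] => w [].
have := pr_splitI (P k) measurableT mk.
by rewrite prT !setTI pr_init => /esym/eqP; rewrite -subr_eq0 addrAC subrr add0r => /eqP->.
Qed.

Lemma passage_prob_refl s t : 0 < t -> F s s t = 1.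
Proof.
move=> t0; apply/eqP; rewrite eq_le passage_prob_le1/=.
rewrite -(pr_init s); apply: pr_mono; first exact: (at_state_measurable hX).
  exact: hit_measurable.
by move=> w w0; exists 0; rewrite ?lexx// shifted_path0.
Qed.

Lemma passage_prob0 k s t : t <= 0 -> F k s t = 0.
Proof.
move=> t0; rewrite /passage_prob (_ : _ @^-1` _ = set0) ?pr0// -subset0.
by move=> w [u /andP[u0 ut]]; have := le_lt_trans u0 (lt_le_trans ut t0); rewrite ltxx.
Qed.

Lemma first_passage_event k s t : k <> s ->
  pr (P k) [set w | (first_passage_time X s w < t%:E)%E] = F k s t.
Proof.
move=> ks.
have mh := hit_measurable s t (lexx 0).
pose G := [set w | exists2 u, 0 < u < t & X u w = s].
have -> : [set w | (first_passage_time X s w < t%:E)%E] = G.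
  apply/seteqP; split => w /=.
    move=> /ereal_inf_lt[_ [u [u0 us] <-]]; rewrite lte_fin => ut.
    by exists u => //; rewrite u0.
  move=> [u /andP[u0 ut] us]; apply: (@le_lt_trans _ _ u%:E).
    by apply: ereal_inf_lbound; exists u.
  by rewrite lte_fin.
have mG : measurable G.
  (* A positive visiting time is at least some [h n], so [G] is a countable union of hits of shifted
     paths. *)
  pose h n : R := n.+1%:R^-1.
  have h0 n : 0 <= h n by rewrite invr_ge0.
  rewrite (_ : G = \bigcup_n (shift (h n) @^-1` hit s (t - h n))).
    by apply: bigcupT_measurable => n; exact: hit_measurable.
  apply/seteqP; split => w.
    move=> [u /andP[u0 ut] us]; exists (Num.truncn u^-1) => //.
    exists (u - h (Num.truncn u^-1)); last by rewrite /shifted_path addrC subrK.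
    rewrite ltrD2r ut subr_ge0 andbT /h -[leRHS]invrK lef_pV2 ?posrE ?invr_gt0//.
    by rewrite ltW// truncnS_gt.
  move=> [n _ [u /andP[u0 ut] us]]; exists (h n + u) => //.
  by rewrite -ltrBrDl ut ltr_wpDr// invr_gt0.
(* The two events can differ only by a visit at time 0, which [ev 0 k] excludes because [k <> s]. *)
have GE : shift 0 @^-1` hit s t `&` ev 0 k = G `&` ev 0 k.
  apply/seteqP; split => w [[u /andP[u0 ut] us] w0]; split => //.
    rewrite shifted_path0 in us.
    exists u => //; rewrite ut andbT lt_def u0 andbT; apply/eqP => u00.
    by apply: ks; rewrite -w0 -us u00.
  by exists u; rewrite ?(ltW u0)// shifted_path0.
by rewrite /passage_prob (pr_I_init k mG) -GE -(pr_I_init k mh).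
Qed.

End passage.

(** * One-step upper bounds for hitting *)

Section backward.
Context (R : realType) (d : measure_display) (T : measurableType d).
Context (P : int -> probability T R) (X : R -> T -> int) (lambda mu : int -> R).
Hypothesis hX : bilateral_birth_death P X lambda mu.

Local Notation p := (transition_prob P X).
Local Notation ev := (at_state X).
Local Notation shift := (shifted_path X).
Local Notation F := (passage_prob P X).

Lemma grid_hitS s j (h : R) :
  grid_hit s j.+1 h = grid_hit s j h `|` [set x | x (j%:R * h) = s].
Proof.
apply/seteqP; split => x.
  move=> [i]; rewrite ltnS leq_eqVlt => /predU1P[->|ij] xi; [by right|left].
  by exists i.
by move=> [[i ij xi]|xj]; [exists i => //; exact: ltnW ij|exists j].
Qed.

Lemma grid_hit_event s j (h : R) : 0 <= h ->
  path_events `[0, j%:R * h]%classic (grid_hit s j h).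
Proof.
move=> h0; elim: j => [|j IH].
  by rewrite (_ : grid_hit s 0 h = set0); [exact: path_events0|rewrite -subset0 => x []].
have jj : j%:R * h <= j.+1%:R * h by rewrite ler_wpM2r// ler_nat.
rewrite grid_hitS; apply: path_eventsU.
  by apply: path_events_subset IH; apply: subset_itvl; rewrite bnd_simp.
by apply: path_events_coord; rewrite /= in_itv /= mulr_ge0//=.
Qed.

(* Split according to the first grid time at which [s] is hit: the chain then has
   to leave [s] before time [h]. *)
Lemma hit_leave_le k s (h c : R) : 0 < h ->
  (forall u : R, 0 < u <= h -> 1 - p s s u <= c) ->
  pr (P k) (shift 0 @^-1` hit s h `&` ~` ev h s) <= c * F k s h.
Proof.
move=> h0 hc.
have mev : measurable (ev h s) by apply: (at_state_measurable hX); exact: ltW.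
have mevC := measurableC mev.
have c0 : 0 <= c.
  apply: le_trans (hc h _); last by rewrite h0 lexx.
  by rewrite subr_ge0; apply: pr_le1.
pose g N : R := h / N.+1%:R.
have g0 N : 0 < g N by rewrite divr_gt0.
pose D N j := shift 0 @^-1` grid_hit s j (g N).
have mD N j : measurable (D N j).
  apply: (past_measurable hX (t := j%:R * g N)); first by rewrite mulr_ge0// ltW.
  by apply: grid_hit_event; exact: ltW.
have key N j : (j <= N.+1)%N ->
    pr (P k) (D N j `&` ~` ev h s) <= c * pr (P k) (D N j).
  elim: j => [|j IH] jN.
    rewrite (_ : D N 0%N = set0) ?set0I ?pr0 ?mulr0//.
    by rewrite -subset0 => w [].
  have jg : j%:R * g N < h.
    by rewrite /g mulrA ltr_pdivrMr// mulrC ltr_pM2l// ltr_nat.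
  have jg0 : 0 <= j%:R * g N by rewrite mulr_ge0// ltW.
  have hjg : 0 <= h - j%:R * g N by rewrite subr_ge0 ltW.
  pose E := ~` D N j `&` ev (j%:R * g N) s.
  have mj := at_state_measurable hX s jg0.
  have mE : measurable E by apply: measurableI => //; exact: measurableC.
  have DE : D N j.+1 = D N j `|` E.
    rewrite /D grid_hitS; apply/seteqP; split => w.
      move=> [wj|wj]; first by left.
      have [wD|wD] := pselect ((shift 0 @^-1` grid_hit s j (g N)) w); first by left.
      by right; split => //; move: wj; rewrite /= shifted_path0.
    move=> [wj|[_ wj]]; [by left|right].
    by rewrite /= shifted_path0.
  (* Having no earlier grid hit is a past event, so given [E] the chance of being at [s] at time [h]
     is [p s s] of the remaining time. *)
  have EE : pr (P k) (E `&` ~` ev h s) <= c * pr (P k) E.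
    have := markov_past hX k s s jg0 hjg
      (path_eventsC (@grid_hit_event s j _ (ltW (g0 N)))).
    rewrite addrC subrK => mk.
    have := pr_splitI (P k) mE mev.
    have -> : E `&` ev h s = (ev (j%:R * g N) s `&` ev h s) `&`
        shift 0 @^-1` (~` grid_hit s j (g N)).
      by rewrite [RHS]setIC [in RHS]setIA.
    rewrite mk (_ : ev (j%:R * g N) s `&` _ = E); last by rewrite setIC.
    move=> pE; have -> : pr (P k) (E `&` ~` ev h s) =
        (1 - p s s (h - j%:R * g N)) * pr (P k) E.
      by rewrite mulrBl mul1r; apply/eqP; rewrite eq_sym subr_eq addrC -pE.
    apply: ler_wpM2r; first exact: pr_ge0.
    apply: hc; rewrite subr_gt0 jg/= gerBl//.
  rewrite DE setIUl prU//.
  - rewrite prU//; first by rewrite mulrDr lerD// IH// ltnW.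
    by rewrite -subset0 => w [wD []].
  - exact: measurableI.
  - exact: measurableI.
  - by rewrite -subset0 => w [[wD _] [[]]].
apply: (@pr_liminf_le _ _ _ _ _ (fun K N => D N N.+1 `&` ~` ev h s)).
- apply: measurableI => //; apply: (hit_measurable hX); exact: lexx.
- by move=> _ N; exact: measurableI.
- by move=> K K' N _ w.
- move=> w [wh ws].
  have [K HK] := hit_grid_hit (shifted_path_right_continuous hX w (lexx 0)) wh.
  by exists K => // N /= KN; split => //; exact: HK.
move=> K e e0; exists K => //; apply: le_trans (key _ _ (leqnn _)) _.
apply: ler_wpDr; first exact: ltW.
apply: ler_wpM2l => //; apply: pr_mono => //.
  by apply: (hit_measurable hX); exact: lexx.
move=> w [i iK wi]; exists (i%:R * g K) => //.
have -> /= : 0 <= i%:R * g K by rewrite mulr_ge0// ltW.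
by rewrite /g mulrA ltr_pdivrMr// mulrC ltr_pM2l// ltr_nat.
Qed.

(** Either the process is at [s] at time [h], or it hit [s] and left again, which [hit_leave_le]
    controls. *)
Lemma passage_prob_small k s (h c : R) : 0 < h ->
  (forall u : R, 0 < u <= h -> 1 - p s s u <= c) -> F k s h <= p k s h + c.
Proof.
move=> h0 hc; have mev := at_state_measurable hX s (ltW h0).
have mh := hit_measurable hX s h (lexx 0).
have c0 : 0 <= c.
  apply: le_trans (hc h _); last by rewrite h0 lexx.
  by rewrite subr_ge0; apply: pr_le1.
rewrite [leLHS](pr_splitI _ mh mev) lerD//.
  by apply: pr_mono => //; exact: measurableI.
apply: le_trans (hit_leave_le k h0 hc) _.
by rewrite ler_piMr// (passage_prob_le1 hX).
Qed.

(** A hit before [h + t] either occurs from time [h] on, or is earlier with the process away from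
    [s] at time [h]. The mass outside [l] at time [h] is counted in full. *)
Lemma passage_prob_le_step k s (h t c : R) (l : seq int) : 0 < h -> 0 < t ->
  uniq l -> (forall u : R, 0 < u <= h -> 1 - p s s u <= c) ->
  F k s (h + t) <= \sum_(n <- l) p k n h * F n s t +
    (1 - \sum_(n <- l) p k n h) + c * F k s h.
Proof.
move=> h0 t0 ul hc; have mev := at_state_measurable hX s (ltW h0).
have m0 := hit_measurable hX s h (lexx 0).
have mht := hit_measurable hX s (h + t) (lexx 0).
have mh := hit_measurable hX s t (ltW h0).
have ml := at_states_measurable hX l (ltW h0).
have mevC := measurableC mev; have mlC := measurableC ml.
have m0C : measurable (shift 0 @^-1` hit s h `&` ~` ev h s) by exact: measurableI.
apply: (@le_trans _ _ (pr (P k) (shift h @^-1` hit s t `|`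
    (shift 0 @^-1` hit s h `&` ~` ev h s)))).
  apply: pr_mono => //; first exact: measurableU.
  move=> w [u /andP[u0 uht] us]; rewrite shifted_path0 in us.
  have [uh|hu] := ltP u h.
    (* A path sitting at [s] at time [h] is a hit of the shifted path at its time 0, which lies
       before [t]. *)
    have [wh|wh] := pselect (X h w = s).
      by left; exists 0; rewrite ?lexx// /shifted_path addr0.
    by right; split => //; exists u; rewrite ?u0// shifted_path0.
  left; exists (u - h); first by rewrite subr_ge0 hu ltrBlDl.
  by rewrite /shifted_path addrC subrK.
apply: le_trans (prU_le _ mh m0C) _; rewrite lerD ?hit_leave_le//.
rewrite (pr_splitI _ mh ml) lerD//.
  rewrite -(pr_sum_at_state hX)//; last exact: ltW.
  rewrite le_eqVlt; apply/orP; left; apply/eqP; apply: eq_bigr => n _.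
  by rewrite setIC (markov_hit hX)// ltW.
rewrite (transition_sum hX)//; last exact: ltW.
have := pr_splitI (P k) measurableT ml; rewrite prT !setTI => ->.
by rewrite [leRHS]addrC addKr; apply: pr_mono => //; exact: measurableI.
Qed.

End backward.

(** * Derivatives from right increments *)

Section calculus.
Context (R : realType).

Lemma right_slope_bound (f : R -> R) (l e : R) :
  f h / h @[h --> 0^'+] --> l -> 0 < e ->
  exists2 r, 0 < r & forall h, 0 < h < r -> `|f h - l * h| <= e * h.
Proof.
move=> /cvgrPdist_le /[apply] -[r /= r0 Hr]; exists r => // h /andP[h0 hr].
have -> : f h - l * h = (f h / h - l) * h by rewrite mulrBl divfK// gt_eqF.
rewrite normrM (gtr0_norm h0) ler_wpM2r ?(ltW h0)// distrC; apply: Hr => //.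
by rewrite /= sub0r normrN gtr0_norm.
Qed.

(** The increment bound is uniform in the base point, so a left difference quotient at [t] is a
    right one started at [t + h]; continuity of [D] then replaces [D (t + h)] by [D t]. *)
Lemma is_derive_right_increment (f D : R -> R) (t : R) : 0 < t ->
  {for t, continuous D} ->
  (forall e, 0 < e -> exists2 r, 0 < r & forall h u, 0 < h < r -> 0 < u ->
     `|f (u + h) - f u - h * D u| <= e * h) ->
  is_derive t 1 f (D t).
Proof.
move=> t0 cD H.
suff key : h^-1 *: (f (h *: 1 + t) - f t) @[h --> 0^'] --> D t.
  split; first by apply/cvg_ex; exists (D t).
  exact: cvg_lim.
apply/cvgrPdist_le => e e0.
have e20 : 0 < e / 2 by rewrite divr_gt0.
have [r r0 Hr] := H _ e20.
have /cvgrPdist_le/(_ _ e20)[r' /= r'0 Hr'] := cD.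
(* The bound [t] keeps the base point [t + h] positive when [h < 0]. *)
exists (Num.min (Num.min r r') t) => /=; first by rewrite !lt_min r0 r'0.
move=> h /=; rewrite sub0r normrN !lt_min => /andP[/andP[hr hr'] ht] hn0.
rewrite [h *: 1]mulr1 -[_ *: _]/(h^-1 * _).
have [h0|h0|h0] := ltgtP h 0; last by rewrite h0 eqxx in hn0.
  rewrite (ltr0_norm h0) in hr hr' ht.
  have th0 : 0 < h + t by rewrite -ltrBlDl sub0r.
  have hrr : 0 < - h < r by rewrite oppr_gt0 h0.
  have := Hr (- h) (h + t) hrr th0.
  have -> : h + t - h = t by rewrite addrAC subrr add0r.
  move=> Hf.
  have Df : `|D t - D (h + t)| <= e / 2.
    by apply: Hr'; rewrite /= opprD addrCA subrr addr0 normrN ltr0_norm.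
  have -> : D t - h^-1 * (f (h + t) - f t) =
      (D t - D (h + t)) - (- h)^-1 * (f t - f (h + t) - (- h) * D (h + t)).
    by field; rewrite lt_eqF.
  apply: le_trans (ler_normB _ _) _; rewrite [leRHS]splitr lerD//.
  rewrite normrM gtr0_norm ?invr_gt0 ?oppr_gt0// mulrC ler_pdivrMr ?oppr_gt0//.
rewrite (gtr0_norm h0) in hr hr' ht.
have := Hr h t; rewrite h0 hr => /(_ isT t0).
rewrite [t + h]addrC => Hf.
have -> : D t - h^-1 * (f (h + t) - f t) = - (h^-1 * (f (h + t) - f t - h * D t)).
  by field; rewrite gt_eqF.
rewrite normrN normrM gtr0_norm ?invr_gt0// mulrC ler_pdivrMr//.
apply: le_trans Hf _; rewrite ler_wpM2r ?(ltW h0)//.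
by rewrite ler_pdivrMr// ler_pMr// ler1n.
Qed.

End calculus.

(** * The backward equation for passage probabilities *)

Lemma neighbours_uniq (k : int) : uniq [:: k; k + 1; k - 1].
Proof. by rewrite /= !inE; lia. Qed.

Section backward_equation.
Context (R : realType) (d : measure_display) (T : measurableType d).
Context (P : int -> probability T R) (X : R -> T -> int) (lambda mu : int -> R).
Hypothesis hX : bilateral_birth_death P X lambda mu.

Local Notation p := (transition_prob P X).
Local Notation F := (passage_prob P X).

Let lambda_gt0 n : 0 < lambda n. Proof. exact: (bbd_lambda_gt0 hX). Qed.
Let mu_gt0 n : 0 < mu n. Proof. exact: (bbd_mu_gt0 hX). Qed.

(** The summand 1 absorbs the o(h) term of the exit rate and gives a linear bound for all small
    times. *)
Definition exit_slope n := lambda n + mu n + 1.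
Local Notation c := exit_slope.

Lemma exit_slope_ge0 n : 0 <= c n.
Proof. by rewrite !addr_ge0// ltW. Qed.

Lemma exit_bound n : exists2 r, 0 < r & forall h, 0 < h < r ->
  forall u, 0 < u <= h -> 1 - p n n u <= c n * h.
Proof.
have [r r0 Hr] := right_slope_bound (@bd_exit_rate _ _ _ _ (bbd_transition hX) n) ltr01.
exists r => // h /andP[h0 hr] u /andP[u0 uh].
have := Hr u; rewrite u0 (le_lt_trans uh hr) => /(_ isT).
move=> /(le_trans (ler_norm _)); rewrite mul1r lerBlDl => Hu.
apply: (@le_trans _ _ (c n * u)); first by rewrite mulrDl mul1r.
by rewrite ler_wpM2l// exit_slope_ge0.
Qed.

Lemma transition_le_exit k n (h : R) : n != k -> 0 <= h -> p k n h <= 1 - p k k h.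
Proof.
move=> nk h0; rewrite lerBrDl.
have := transition_sum_le1 hX k h0 (l := [:: k; n]).
by rewrite big_cons big_seq1; apply; rewrite /= inE eq_sym nk.
Qed.

Lemma passage_prob_small_bound k s : k <> s -> exists2 r, 0 < r & forall h,
  0 < h < r -> F k s h <= (c k + c s) * h.
Proof.
move=> ks; have [r r0 Hr] := exit_bound k; have [r' r'0 Hr'] := exit_bound s.
exists (Num.min r r'); first by rewrite lt_min r0.
move=> h /andP[h0]; rewrite lt_min => /andP[hr hr'].
have := passage_prob_small hX k h0 (Hr' h _); rewrite h0 hr' => /(_ isT).
move=> /le_trans; apply; rewrite [leRHS]mulrDl lerD2r.
apply: le_trans (transition_le_exit _ (ltW h0)) _.
  by apply/eqP => sk; exact: ks.
by apply: Hr; rewrite ?h0 ?lexx.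
Qed.

(** In [passage_prob_le_step] with [l = [:: k]], leaving [k] and leaving [s] cost at most [c k * h]
    and [c s * h]. Being uniform in [t], the bound yields continuity by monotonicity. *)
Lemma passage_prob_increment_le k s : k <> s -> exists2 r, 0 < r & forall h t,
  0 < h < r -> F k s (t + h) - F k s t <= (c k + c s) * h.
Proof.
move=> ks; have [r r0 Hr] := exit_bound k; have [r' r'0 Hr'] := exit_bound s.
have [r2 r20 Hr2] := passage_prob_small_bound ks.
exists (Num.min (Num.min r r') r2); first by rewrite !lt_min r0 r'0.
move=> h t /andP[h0]; rewrite !lt_min => /andP[/andP[hr hr'] hr2].
have [t0|t0] := leP t 0.
  rewrite [in X in _ - X]passage_prob0// subr0.
  apply: le_trans (passage_prob_nondecreasing hX k s (_ : t + h <= h)) _.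
    by rewrite gerDr.
  by apply: Hr2; rewrite h0.
have := passage_prob_le_step hX k h0 t0 (l := [:: k]) isT (Hr' h _).
rewrite h0 hr' => /(_ isT); rewrite !big_seq1 [h + t]addrC => H.
have pF : p k k h * F k s t <= F k s t.
  rewrite ler_piMl ?passage_prob_ge0//.
  by apply: pr_le1; apply: (at_state_measurable hX); exact: ltW.
have cF : c s * h * F k s h <= c s * h.
  by rewrite ler_piMr ?(passage_prob_le1 hX)// mulr_ge0 ?exit_slope_ge0 ?ltW.
have e1 : 1 - p k k h <= c k * h by apply: Hr; rewrite ?h0 ?lexx.
by rewrite [leRHS]mulrDl; lra.
Qed.

Lemma passage_prob_continuous k s : k <> s -> continuous (F k s).
Proof.
move=> ks t; apply/cvgrPdist_le => e e0.
have [r r0 Hr] := passage_prob_increment_le ks.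
pose C := c k + c s.
have C0 : 0 < C by rewrite /C /exit_slope !addr_gt0.
exists (Num.min r (e / C)) => /=; first by rewrite lt_min r0 divr_gt0.
move=> u /=; rewrite lt_min => /andP[tur].
rewrite ltr_pdivlMr// => tue.
have key a b : a < b -> `|a - b| < r -> `|a - b| * C < e ->
    `|F k s a - F k s b| <= e.
  move=> ab; rewrite distrC gtr0_norm ?subr_gt0// => abr abe.
  rewrite distrC ger0_norm ?subr_ge0 ?(passage_prob_nondecreasing hX) ?(ltW ab)//.
  have := Hr (b - a) a; rewrite subr_gt0 ab abr => /(_ isT).
  rewrite [a + _]addrC subrK => /le_trans; apply.
  by rewrite mulrC ltW.
have [tu|ut|<-] := ltgtP t u; last by rewrite subrr normr0 ltW.
  exact: key.
by rewrite distrC; apply: key => //; rewrite distrC.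
Qed.

(* [passage_prob] vanishes at time 0 even for [n = s]; the backward equation
   needs the boundary value 1 there. *)
Definition passage_bd n s t := if n == s then 1 else F n s t.

Lemma passage_bd_continuous n s : continuous (passage_bd n s).
Proof.
rewrite /passage_bd; have [_|/eqP ns] := eqVneq n s; first exact: cst_continuous.
exact: passage_prob_continuous.
Qed.

Lemma passage_bd_ge0 n s t : 0 <= passage_bd n s t.
Proof. by rewrite /passage_bd; case: ifP => // _; exact: passage_prob_ge0. Qed.

Lemma passage_bd_le1 n s t : passage_bd n s t <= 1.
Proof. by rewrite /passage_bd; case: ifP => // _; exact: (passage_prob_le1 hX). Qed.

Lemma passage_bdE n s t : 0 < t -> F n s t = passage_bd n s t.
Proof.
by move=> t0; rewrite /passage_bd; case: eqP => [->|//]; exact: (passage_prob_refl hX).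
Qed.

(** This is the right-hand side of the Kolmogorov backward equation. *)
Definition passage_deriv k s t :=
  lambda k * passage_bd (k + 1) s t + mu k * passage_bd (k - 1) s t -
  (lambda k + mu k) * F k s t.

Lemma passage_deriv_continuous k s : k <> s -> continuous (passage_deriv k s).
Proof.
move=> ks t; apply: cvgB; last by apply: cvgMr; exact: passage_prob_continuous.
by apply: cvgD; apply: cvgMr; exact: passage_bd_continuous.
Qed.

(** [passage_prob_ge_step] and [passage_prob_le_step] for [k] and its two neighbours squeeze the
    increment; the mass elsewhere is o(h) by the exit rate. *)
Lemma passage_prob_increment k s : k <> s -> forall e, 0 < e ->
  exists2 r, 0 < r & forall h t, 0 < h < r -> 0 < t ->
  `|F k s (t + h) - F k s t - h * passage_deriv k s t| <= e * h.
Proof.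
move=> ks e e0; have e80 : 0 < e / 8 by rewrite divr_gt0.
have bd := bbd_transition hX.
have [r1 r10 H1] := right_slope_bound (@bd_birth_rate _ _ _ _ bd k) e80.
have [r2 r20 H2] := right_slope_bound (@bd_death_rate _ _ _ _ bd k) e80.
have [r3 r30 H3] := right_slope_bound (@bd_exit_rate _ _ _ _ bd k) e80.
have [r4 r40 H4] := exit_bound s.
have [r5 r50 H5] := passage_prob_small_bound ks.
(* The term [c s * h * F k s h] is at most [C * h * h], hence at most [e / 8 * h] for
   [h < e / 8 / C]. The three slope errors have the same size, so the total stays below [e * h]. *)
pose C := c s * (c k + c s) + 1.
have C0 : 0 < C.
  by apply: ltr_wpDl => //; apply: mulr_ge0; [|apply: addr_ge0]; exact: exit_slope_ge0.
exists (Num.min (Num.min (Num.min r1 r2) (Num.min r3 r4)) (Num.min r5 (e / 8 / C))).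
  by rewrite !lt_min r10 r20 r30 r40 r50 divr_gt0.
move=> h t /andP[h0]; rewrite !lt_min => /andP[/andP[/andP[h1 h2] /andP[h3 h4]]].
move=> /andP[h5 h6] t0.
have {}H1 := H1 h; rewrite h0 h1 in H1; have {H1} := H1 isT.
have {}H2 := H2 h; rewrite h0 h2 in H2; have {H2} := H2 isT.
have {}H3 := H3 h; rewrite h0 h3 in H3; have {H3} := H3 isT.
have {}H5 := H5 h; rewrite h0 h5 in H5; have {}H5 := H5 isT.
have {}H4 := H4 h; rewrite h0 h4 in H4; have {}H4 := H4 isT.
have ul := neighbours_uniq k.
have := passage_prob_le_step hX k h0 t0 ul H4.
have := passage_prob_ge_step hX k s t (ltW h0) ul.
have := transition_sum_le1 hX k (ltW h0) ul.
rewrite !big_cons !big_nil !addr0 (passage_bdE (k + 1) s t0) (passage_bdE (k - 1) s t0).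
rewrite [h + t]addrC /passage_deriv.
have Ch : c s * h * F k s h <= e / 8 * h.
  apply: (@le_trans _ _ (c s * h * ((c k + c s) * h))).
    by rewrite ler_wpM2l// mulr_ge0 ?exit_slope_ge0 ?ltW.
  have -> : c s * h * ((c k + c s) * h) = (c s * (c k + c s) * h) * h by ring.
  rewrite ler_wpM2r ?(ltW h0)//.
  rewrite ltr_pdivlMr// in h6; apply: le_trans _ (ltW h6).
  by rewrite mulrC ler_wpM2l ?(ltW h0)// ler_wpDr.
have := passage_bd_le1 (k + 1) s t; have := passage_bd_ge0 (k + 1) s t.
have := passage_bd_le1 (k - 1) s t; have := passage_bd_ge0 (k - 1) s t.
have := passage_prob_le1 hX k s t; have := passage_prob_ge0 P X k s t.
move: (passage_bd (k + 1) s t) (passage_bd (k - 1) s t) (F k s t) => u v f.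
move: (p k (k + 1) h) (p k (k - 1) h) (p k k h) (F k s (t + h)) Ch => pu pv pf g.
move=> Ch f0 f1 v0 v1 u0 u1 S1 S2 S3.
rewrite !ler_norml => /andP[A1 A2] /andP[B1 B2] /andP[C1 C2].
have e8h : 0 <= e / 8 * h by rewrite mulr_ge0 ?ltW.
apply/andP; split; nra.
Qed.

End backward_equation.

(** * The crossing probability as a positive limit *)

Section crossing.
Context (R : realType) (d : measure_display) (T : measurableType d).
Context (P : int -> probability T R) (X : R -> T -> int) (lambda mu : int -> R).
Hypothesis hX : bilateral_birth_death P X lambda mu.

Local Notation p := (transition_prob P X).
Local Notation F := (passage_prob P X).
Local Notation D := (passage_deriv P X lambda mu).

Lemma passage_prob_is_derive k s (t : R) : k <> s -> 0 < t ->
  is_derive t 1 (F k s) (D k s t).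
Proof.
move=> ks t0; apply: is_derive_right_increment => //.
  exact: (passage_deriv_continuous hX).
exact: (passage_prob_increment hX).
Qed.

(** For [t > 0] the value is approximated by difference quotients of a nondecreasing function; for
    [t <= 0] the negative term vanishes. *)
Lemma passage_deriv_ge0 k s (t : R) : k <> s -> 0 <= D k s t.
Proof.
move=> ks; have l0 := bbd_lambda_gt0 hX k; have m0 := bbd_mu_gt0 hX k.
have [t0|t0] := leP t 0.
  rewrite /passage_deriv (passage_prob0 P X k s t0) mulr0 subr0.
  by rewrite addr_ge0// mulr_ge0 ?passage_bd_ge0// ltW.
apply/ler_addgt0Pr => e e0.
have [r r0 Hr] := passage_prob_increment hX ks e0.
have h0 : 0 < r / 2 < r by rewrite divr_gt0//= ltr_pdivrMr// ltr_pMr// ltr1n.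
have := Hr _ _ h0 t0; rewrite ler_norml => /andP[_].
have : F k s t <= F k s (t + r / 2).
  by apply: (passage_prob_nondecreasing hX); rewrite lerDl; case/andP: h0 => /ltW.
case/andP: h0 => h0 _ Fle.
rewrite lerBlDr => Hle.
have : 0 <= (D k s t + e) * (r / 2) by rewrite mulrDl; lra.
by rewrite pmulr_lge0.
Qed.

Lemma passage_prob_cvgy k s : k <> s ->
  F k s t @[t --> +oo] --> sup (range (F k s)).
Proof.
move=> ks; apply: nondecreasing_cvgr; first exact: (passage_prob_nondecreasing hX).
by exists 1 => _ [t _ <-]; exact: (passage_prob_le1 hX).
Qed.

Lemma crossing_probE k s : k <> s ->
  crossing_prob P X k s = (sup (range (F k s)))%:E.
Proof.
move=> ks; rewrite /crossing_prob /first_passage_density.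
have -> : (fun t => fine (P k [set w | (first_passage_time X s w < t%:E)%E])) = F k s.
  by apply/funext => t; rewrite -(first_passage_event hX).
have cD := passage_deriv_continuous hX ks.
(* [F k s] vanishes left of 0 and need not be differentiable at 0, so the density is identified on
   the open half-line only. The endpoint is then added as a null set. *)
have dE : {in `]0, +oo[, derive1 (F k s) =1 D k s}.
  move=> t; rewrite in_itv/= andbT => t0; rewrite derive1E.
  by have [_ ->] := passage_prob_is_derive ks t0.
transitivity (\int[lebesgue_measure]_(t in `]0%R, +oo[) (D k s t)%:E)%E.
  by apply: eq_integral => t; rewrite inE /= => /dE ->.
rewrite integral_itv_obnd_cbnd; last first.
  apply/measurable_EFinP; apply: measurable_funTS.
  exact: continuous_measurable_fun.
rewrite (ge0_continuous_FTC2y _ _ (passage_prob_cvgy ks)) ?(passage_prob0 P X k s (lexx 0)) ?sube0//.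
- by move=> t _; exact: passage_deriv_ge0.
- exact: continuous_subspaceT.
- by move=> t t0; have [] := passage_prob_is_derive ks t0.
- rewrite -[Y in _ --> Y](passage_prob0 P X k s (lexx 0)).
  apply: cvg_at_right_filter.
  exact: (passage_prob_continuous hX).
Qed.

Lemma right_slope_gt0 (f : R -> R) (l : R) : 0 < l ->
  f h / h @[h --> 0^'+] --> l -> exists2 h, 0 < h & 0 < f h.
Proof.
move=> l0 fl; have l20 : 0 < l / 2 by rewrite divr_gt0.
have [r r0 Hr] := right_slope_bound fl l20.
have h0 : 0 < r / 2 < r by rewrite divr_gt0//= ltr_pdivrMr// ltr_pMr// ltr1n.
exists (r / 2); first by case/andP: h0.
have := Hr _ h0; case/andP: h0 => h0 _; rewrite ler_norml => /andP[+ _].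
rewrite lerBrDl; apply: lt_le_trans.
by rewrite -mulrBl mulr_gt0// subr_gt0 ltr_pdivrMr// ltr_pMr// ltr1n.
Qed.

Lemma transition_reachable_step k m n (u h : R) : 0 <= u -> 0 < h ->
  0 < p k m u -> 0 < p m n h -> exists2 v, 0 <= v & 0 < p k n v.
Proof.
move=> u0 h0 pu ph; exists (u + h); first by rewrite addr_ge0// ltW.
apply: lt_le_trans (mulr_gt0 pu ph) _.
rewrite -(markov_transition hX k m n u0 (ltW h0)).
have uh0 : 0 <= u + h by rewrite addr_ge0// ltW.
apply: pr_mono; first by apply: measurableI; exact: (at_state_measurable hX).
  exact: (at_state_measurable hX).
by move=> w [].
Qed.

(** Each positive rate makes the corresponding unit step possible in some positive time; such steps
    are chained from [k] to [s]. *)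
Lemma transition_reachable k s : exists2 u, 0 <= u & 0 < p k s u.
Proof.
have bd := bbd_transition hX.
have base : exists2 u, 0 <= u & 0 < p k k u.
  by exists 0 => //; rewrite (bd_init bd) eqxx ltr01.
have up n : exists2 u, 0 <= u & 0 < p k (k + n%:Z) u.
  elim: n => [|n [u u0 pu]]; first by rewrite addr0.
  have [h h0 ph] := right_slope_gt0 (bbd_lambda_gt0 hX (k + n%:Z))
    (@bd_birth_rate _ _ _ _ bd (k + n%:Z)).
  have -> : k + n.+1%:Z = k + n%:Z + 1 by rewrite -addrA -addn1.
  exact: transition_reachable_step u0 h0 pu ph.
have down n : exists2 u, 0 <= u & 0 < p k (k - n%:Z) u.
  elim: n => [|n [u u0 pu]]; first by rewrite subr0.
  have [h h0 ph] := right_slope_gt0 (bbd_mu_gt0 hX (k - n%:Z))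
    (@bd_death_rate _ _ _ _ bd (k - n%:Z)).
  have -> : k - n.+1%:Z = k - n%:Z - 1 by rewrite -addrA -opprD -addn1.
  exact: transition_reachable_step u0 h0 pu ph.
have := up `|s - k|%N; have := down `|s - k|%N.
have [ks _|/ltW sk + _] := leP k s.
  by rewrite gez0_abs ?subr_ge0// [k + _]addrC subrK.
by rewrite lez0_abs ?subr_le0// opprK [k + _]addrC subrK.
Qed.

Lemma sup_passage_prob_gt0 k s : 0 < sup (range (F k s)).
Proof.
have [u u0 pu] := transition_reachable k s.
have u10 : 0 <= u + 1 by rewrite addr_ge0.
apply: lt_le_trans pu _; apply: (@le_trans _ _ (F k s (u + 1))).
  apply: pr_mono; [exact: (at_state_measurable hX)|exact: (hit_measurable hX)|].
  by move=> w wu; exists u; [rewrite u0 ltrDl ltr01|rewrite shifted_path0].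
apply: sup_upper_bound; last by exists (u + 1).
by split; [exists (F k s 0), 0|exists 1 => _ [t _ <-]; exact: (passage_prob_le1 hX)].
Qed.

End crossing.

(** * Error terms of order o(h) *)

Section little_o.
Context (R : realType).
Implicit Types f g : R -> R.

(** An upper bound suffices because the error terms it is applied to are nonnegative. *)
Definition little_o f := forall e, 0 < e ->
  exists2 r, 0 < r & forall h, 0 < h < r -> f h <= e * h.

Lemma little_oD f g : little_o f -> little_o g -> little_o (fun h => f h + g h).
Proof.
move=> of_ og e e0; have e20 : 0 < e / 2 by rewrite divr_gt0.
have [r r0 Hr] := of_ _ e20; have [r' r'0 Hr'] := og _ e20.
exists (Num.min r r'); first by rewrite lt_min r0.
move=> h /andP[h0]; rewrite lt_min => /andP[hr hr'].
by rewrite (splitr e) mulrDl lerD ?Hr ?Hr' ?h0.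
Qed.

Lemma little_oM (C : R) f : 0 <= C -> little_o f -> little_o (fun h => f h * C).
Proof.
move=> C0 of_ e e0.
have C10 : 0 < C + 1 by rewrite ltr_wpDl.
have [r r0 Hr] := of_ (e / (C + 1)) (divr_gt0 e0 C10).
exists r => // h hr; apply: le_trans (ler_wpM2r C0 (Hr h hr)) _.
have h0 : 0 <= h by case/andP: hr => /ltW.
rewrite mulrAC ler_wpM2r// mulrAC ler_pdivrMr// ler_wpM2l ?(ltW e0)//.
by rewrite lerDl.
Qed.

Lemma little_o_sum (I : eqType) (l : seq I) (f : I -> R -> R) :
  (forall i, little_o (f i)) -> little_o (fun h => \sum_(i <- l) f i h).
Proof.
move=> of_; elim: l => [|i l IH].
  by move=> e e0; exists 1 => // h /andP[h0 _]; rewrite big_nil mulr_ge0 ?ltW.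
move=> e e0; have [r r0 Hr] := little_oD (of_ i) IH e0.
by exists r => // h hr; rewrite big_cons Hr.
Qed.

Lemma le_little_o f g : (forall h, 0 < h -> f h <= g h) -> little_o g -> little_o f.
Proof.
move=> fg og e e0; have [r r0 Hr] := og e e0; exists r => // h hr.
by apply: le_trans (fg _ _) (Hr h hr); case/andP: hr.
Qed.

End little_o.

(** * Transition probabilities to first order *)

Section generator.
Context (R : realType).

Definition bd_generator (lambda mu : int -> R) (m n : int) : R :=
  if n == m then - (lambda m + mu m) else
  if n == m + 1 then lambda m else
  if n == m - 1 then mu m else 0.

(** For [n] outside [m], [m + 1], [m - 1]: births and deaths already account for the whole exit
    rate, so the remaining mass is o(h). *)
Lemma transition_generator (d : measure_display) (T : measurableType d)
  (P : int -> probability T R) (X : R -> T -> int) (lambda mu : int -> R)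
  (hX : bilateral_birth_death P X lambda mu) m n :
  little_o (fun h => `|transition_prob P X m n h - (n == m)%:R
                       - bd_generator lambda mu m n * h|).
Proof.
have bd := bbd_transition hX; rewrite /bd_generator.
have ex : little_o (fun h => `|1 - transition_prob P X m m h - (lambda m + mu m) * h|).
  by move=> e; exact: right_slope_bound (@bd_exit_rate _ _ _ _ bd m).
have bi : little_o (fun h => `|transition_prob P X m (m + 1) h - lambda m * h|).
  by move=> e; exact: right_slope_bound (@bd_birth_rate _ _ _ _ bd m).
have de : little_o (fun h => `|transition_prob P X m (m - 1) h - mu m * h|).
  by move=> e; exact: right_slope_bound (@bd_death_rate _ _ _ _ bd m).
have [->|nm] := eqVneq n m.
  apply: le_little_o ex => h h0.
  rewrite -normrN le_eqVlt; apply/orP; left; apply/eqP; congr (`|_|).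
  by rewrite mulr1n; ring.
have [->|nm1] := eqVneq n (m + 1).
  by apply: le_little_o bi => h h0; rewrite subr0.
have [->|nm2] := eqVneq n (m - 1).
  by apply: le_little_o de => h h0; rewrite subr0.
apply: le_little_o (little_oD ex (little_oD bi de)) => h h0.
rewrite subr0 mul0r subr0 ger0_norm; last exact: transition_prob_ge0.
have ul : uniq [:: n; m; m + 1; m - 1].
  by rewrite cons_uniq neighbours_uniq !inE (negbTE nm) (negbTE nm1) (negbTE nm2).
have := transition_sum_le1 hX m (ltW h0) ul.
rewrite !big_cons big_nil addr0 => H.
have A1 := ler_norm (1 - transition_prob P X m m h - (lambda m + mu m) * h).
have A2 := ler_norm (lambda m * h - transition_prob P X m (m + 1) h).
have A3 := ler_norm (mu m * h - transition_prob P X m (m - 1) h).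
rewrite distrC in A2; rewrite distrC in A3.
rewrite mulrDl in A1 *; lra.
Qed.

End generator.

(** * Sampled paths in finite windows *)

Section windows.
Context (R : realType).
Implicit Types (W : seq int) (h : R).

Definition window_stay W (j : nat) h : set (R -> int) :=
  [set x | forall i, (i <= j)%N -> x (i%:R * h) \in W].

(** When [W] omits [s], this says that the first grid visit to [s] is at one of the times [h], ...,
    [j * h], with all earlier samples in [W]. *)
Definition window_hit W s (j : nat) h : set (R -> int) :=
  [set x | exists2 i, (i < j)%N & window_stay W i h x /\ x (i.+1%:R * h) = s].

Lemma path_events_mem (I : set R) W t : I t -> path_events I [set x | x t \in W].
Proof.
move=> It; elim: W => [|n W IH].
  by rewrite (_ : mkset _ = set0); [exact: path_events0|rewrite -subset0].
rewrite (_ : mkset _ = [set x | x t = n] `|` [set x | x t \in W]).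
  by apply: path_eventsU => //; exact: path_events_coord.
apply/seteqP; split => x /=; rewrite inE; first by move=> /predU1P.
by move=> xnW; exact/predU1P.
Qed.

Lemma window_stayS W j h :
  window_stay W j.+1 h = window_stay W j h `&` [set x | x (j.+1%:R * h) \in W].
Proof.
apply/seteqP; split => x.
  by move=> xW; split => [i ij|]; apply: xW => //; exact: leqW.
by move=> [xj xj1] i; rewrite leq_eqVlt ltnS => /predU1P[->//|/xj].
Qed.

Lemma window_hitS W s j h :
  window_hit W s j.+1 h =
  window_hit W s j h `|` (window_stay W j h `&` [set x | x (j.+1%:R * h) = s]).
Proof.
apply/seteqP; split => x.
  move=> [i]; rewrite ltnS leq_eqVlt => /predU1P[->|ij] [xi xs]; first by right.
  by left; exists i.
move=> [[i ij xi]|[xj xs]]; last by exists j.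
by exists i => //; exact: ltnW ij.
Qed.

Lemma window_stay_event W j h : 0 <= h ->
  path_events `[0, j%:R * h]%classic (window_stay W j h).
Proof.
move=> h0; elim: j => [|j IH].
  rewrite (_ : window_stay W 0 h = [set x | x 0 \in W]).
    by apply: path_events_mem; rewrite /= in_itv /= mul0r lexx.
  apply/seteqP; split => x; first by move/(_ 0%N isT); rewrite mul0r.
  by move=> x0 i; rewrite leqn0 => /eqP ->; rewrite mul0r.
rewrite window_stayS; apply: path_eventsI.
  apply: path_events_subset IH; apply: subset_itvl; rewrite bnd_simp.
  by rewrite ler_wpM2r// ler_nat.
by apply: path_events_mem; rewrite /= in_itv /= mulr_ge0//=.
Qed.

Lemma window_hit_event W s j h : 0 <= h ->
  path_events `[0, j%:R * h]%classic (window_hit W s j h).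
Proof.
move=> h0; elim: j => [|j IH].
  by rewrite (_ : window_hit W s 0 h = set0); [exact: path_events0|rewrite -subset0 => x []].
have sub : `[0, j%:R * h]%classic `<=` `[0, j.+1%:R * h]%classic.
  by apply: subset_itvl; rewrite bnd_simp ler_wpM2r// ler_nat.
rewrite window_hitS; apply: path_eventsU; first exact: path_events_subset IH.
apply: path_eventsI.
  by apply: (path_events_subset sub); exact: window_stay_event.
by apply: path_events_coord; rewrite /= in_itv /= mulr_ge0//=.
Qed.

Definition window (s : int) (K : nat) : seq int :=
  [seq n <- [seq (i%:Z - K%:Z) | i <- iota 0 (2 * K).+1] | n != s].

Lemma mem_window s K n : (n \in window s K) = (n != s) && (`|n|%N <= K)%N.
Proof.
rewrite mem_filter; congr (_ && _); apply/mapP/idP => [[i]|nK].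
  by rewrite mem_iota; lia.
by exists (absz (n + K%:Z)); [rewrite mem_iota|]; lia.
Qed.

Lemma window_uniq s K : uniq (window s K).
Proof.
by rewrite filter_uniq// map_inj_uniq ?iota_uniq// => i j; lia.
Qed.

Lemma window_hit_subset s j h K K' : (K <= K')%N ->
  window_hit (window s K) s j h `<=` window_hit (window s K') s j h.
Proof.
move=> KK' x [i ij [xi xs]]; exists i => //; split => // i' /xi.
by rewrite !mem_window => /andP[-> /leq_trans->].
Qed.

(** The first grid visit to [s] has positive index because the path starts elsewhere, and all
    earlier samples avoid [s]. *)
Lemma window_hit_bounded x s j h K : x 0 <> s ->
  grid_hit s j.+1 h x -> (forall i, (i <= j)%N -> (`|x (i%:R * h)%R| <= K)%N) ->
  window_hit (window s K) s j h x.
Proof.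
move=> x0 [i ij xi] xK.
have ex : exists i, (x (i%:R * h) == s) by exists i; exact/eqP.
case: (ex_minnP ex) => -[|m] /eqP xm mmin; first by rewrite mul0r in xm.
have mi : (m < i)%N by apply: mmin; exact/eqP.
have mj : (m < j)%N by apply: leq_trans mi _; rewrite -ltnS.
exists m => //; split => // i' i'm; rewrite mem_window xK ?andbT.
  by apply/negP => /mmin; rewrite ltnNge i'm.
exact: leq_trans i'm (ltnW mj).
Qed.

End windows.

(** * Comparison of passage probabilities under a Doob transform *)

Section comparison.
Context (R : realType).
Context (d : measure_display) (T : measurableType d).
Context (P : int -> probability T R) (X : R -> T -> int) (lambda mu : int -> R).
Context (d' : measure_display) (T' : measurableType d').
Context (P' : int -> probability T' R) (X' : R -> T' -> int) (lambda' mu' : int -> R).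
Context (nu : int -> R).
Hypothesis hX : bilateral_birth_death P X lambda mu.
Hypothesis hX' : bilateral_birth_death P' X' lambda' mu'.
Hypothesis nu_gt0 : forall n, 0 < nu n.
Hypothesis nu_lambda : forall n, nu n * lambda' n = lambda n * nu (n + 1).
Hypothesis nu_mu : forall n, nu n * mu' n = mu n * nu (n - 1).
Hypothesis exit_eq : forall n, lambda' n + mu' n = lambda n + mu n.

Local Notation p := (transition_prob P X).
Local Notation p' := (transition_prob P' X').
Local Notation ev := (at_state X).
Local Notation shift := (shifted_path X).

Let nu_ge0 n : 0 <= nu n. Proof. exact: ltW. Qed.
Let nu_neq0 n : nu n != 0. Proof. by rewrite gt_eqF. Qed.

(** The Doob transform for generators; harmonicity of [nu] enters on the diagonal, through
    [exit_eq]. The hypotheses are symmetric under exchanging the processes and inverting [nu]. *)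
Lemma generator_transform m n : nu m / nu n * bd_generator lambda' mu' m n =
  bd_generator lambda mu m n.
Proof.
rewrite /bd_generator; case: eqVneq => [->|_].
  by rewrite divff// mul1r exit_eq.
case: eqVneq => [->|_]; first by rewrite mulrAC nu_lambda mulfK.
case: eqVneq => [->|_]; first by rewrite mulrAC nu_mu mulfK.
by rewrite mulr0.
Qed.

(** The first-order terms cancel by [generator_transform], and the identity terms because the factor
    is 1 on the diagonal. *)
Lemma transition_transform m n :
  little_o (fun h => `|p m n h - nu m / nu n * p' m n h|).
Proof.
have C0 : 0 <= nu m / nu n by rewrite divr_ge0.
apply: le_little_o (little_oD (transition_generator hX m n)
  (little_oM C0 (transition_generator hX' m n))) => h h0.
have -> : p m n h - nu m / nu n * p' m n h =
    (p m n h - (n == m)%:R - bd_generator lambda mu m n * h) -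
    (p' m n h - (n == m)%:R - bd_generator lambda' mu' m n * h) * (nu m / nu n).
  rewrite -generator_transform; case: eqVneq => [->|_]; last by rewrite mulr0n; ring.
  by rewrite divff// mulr1n; ring.
apply: le_trans (ler_normB _ _) _.
by rewrite lerD2l normrM (ger0_norm C0).
Qed.

(** The intended upper bound for the passage probability of [X]. *)
Definition transformed_passage (n s : int) (t : R) : R :=
  nu n / nu s * passage_prob P' X' n s t.
Local Notation u := transformed_passage.

(** Since [nu n / nu s] dominates [transformed_passage n s], this bounds the cost of replacing one
    step of [X] by the reweighted step of [X']. *)
Definition transform_error (W : seq int) (s m : int) (h : R) : R :=
  \sum_(n <- s :: W) `|p m n h - nu m / nu n * p' m n h| * (nu n / nu s).

Lemma transformed_passage_ge0 n s t : 0 <= u n s t.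
Proof. by rewrite mulr_ge0 ?divr_ge0// passage_prob_ge0. Qed.

Lemma transform_error_ge0 W s m h : 0 <= transform_error W s m h.
Proof. by apply: sumr_ge0 => n _; rewrite mulr_ge0// divr_ge0. Qed.

(** Replacing [p m n h] by [nu m / nu n * p' m n h] cancels [nu n], and [passage_prob_ge_step] for
    [X'] handles what remains. *)
Lemma transformed_passage_step W s m (h t : R) : uniq (s :: W) -> 0 <= h -> 0 < t ->
  p m s h + \sum_(n <- W) p m n h * u n s t <=
  u m s (t + h) + transform_error W s m h.
Proof.
move=> uW h0 t0.
have -> : p m s h + \sum_(n <- W) p m n h * u n s t =
    \sum_(n <- s :: W) p m n h * u n s t.
  rewrite big_cons; congr (_ + _).
  by rewrite /u (passage_prob_refl hX')// divff// !mulr1.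
apply: (@le_trans _ _ (\sum_(n <- s :: W)
    (nu m / nu s * (p' m n h * passage_prob P' X' n s t) +
     `|p m n h - nu m / nu n * p' m n h| * (nu n / nu s)))).
  apply: ler_sum => n _.
  have := passage_prob_le1 hX' n s t; have := passage_prob_ge0 P' X' n s t.
  rewrite /u; move: (passage_prob P' X' n s t) => f f0 f1.
  have := ler_norm (p m n h - nu m / nu n * p' m n h).
  have := normr_ge0 (p m n h - nu m / nu n * p' m n h).
  move: `|_ - _| => e e0 He.
  have -> : p m n h * (nu n / nu s * f) = nu m / nu s * (p' m n h * f) +
      (p m n h - nu m / nu n * p' m n h) * (nu n / nu s) * f.
    by field; rewrite !nu_neq0.
  have C0 : 0 <= nu n / nu s by rewrite divr_ge0.
  rewrite lerD2l; apply: (@le_trans _ _ (e * (nu n / nu s) * f)).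
    by rewrite !ler_wpM2r.
  by rewrite ler_piMr// mulr_ge0.
rewrite big_split /= lerD2r -mulr_sumr ler_wpM2l ?divr_ge0//.
rewrite [t + h]addrC; exact: (passage_prob_ge_step hX').
Qed.

(* Up to the transform error, the left-hand side is a supermartingale in [j]:
   paths that already hit [s] weigh 1, and those still in the window at [m] weigh
   [transformed_passage m s], which at [s] itself equals 1. *)
Lemma window_hit_le W k s (t h : R) j : uniq (s :: W) -> k \in W ->
  0 <= h -> j%:R * h < t ->
  pr (P k) (shift 0 @^-1` window_hit W s j h) +
  \sum_(m <- W) pr (P k) (shift 0 @^-1` window_stay W j h `&` ev (j%:R * h) m) *
    u m s (t - j%:R * h) <=
  u k s t + j%:R * \sum_(m <- W) transform_error W s m h.
Proof.
move=> uW kW h0; have uW' : uniq W by case/andP: uW.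
have jh0 i : 0 <= i%:R * h :> R by rewrite mulr_ge0.
have mst i : measurable (shift 0 @^-1` window_stay W i h).
  exact: (past_measurable hX (jh0 i) (@window_stay_event _ W i _ h0)).
have mhi i : measurable (shift 0 @^-1` window_hit W s i h).
  exact: (past_measurable hX (jh0 i) (@window_hit_event _ W s i _ h0)).
have mev i n : measurable (ev (i%:R * h) n) by exact: (at_state_measurable hX).
elim: j => [_|j IH jt].
  rewrite !mul0r subr0 addr0 (_ : window_hit W s 0 h = set0); last first.
    by rewrite -subset0 => x [].
  (* At time 0 only the state [k] carries mass. *)
  rewrite preimage_set0 pr0 add0r (bigD1_seq k)//= big1 ?addr0; last first.
    move=> m mk; apply/eqP; rewrite mulf_eq0; apply/orP; left.
    rewrite eq_le pr_ge0 andbT.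
    apply: (@le_trans _ _ (pr (P k) (ev 0 m))); last by rewrite (pr_init_neq hX mk).
    apply: pr_mono.
    - by apply: measurableI; [exact: mst|exact: (at_state_measurable hX)].
    - exact: (at_state_measurable hX).
    - by move=> w [].
  rewrite ler_piMl ?transformed_passage_ge0// pr_le1//.
  by apply: measurableI; [exact: mst|exact: (at_state_measurable hX)].
have jt' : j%:R * h < t.
  by apply: le_lt_trans jt; rewrite ler_wpM2r// ler_nat.
apply: le_trans (_ : _ <= u k s t + j%:R * \sum_(m <- W) transform_error W s m h +
   \sum_(m <- W) transform_error W s m h) _; last first.
  by rewrite -addrA lerD2l -[in leRHS]natr1 mulrDl mul1r.
pose t' := t - j.+1%:R * h.
have t'0 : 0 < t' by rewrite subr_gt0.
have tE : t - j%:R * h = t' + h by rewrite /t' -natr1 mulrDl mul1r opprD addrA subrK.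
pose v m := pr (P k) (shift 0 @^-1` window_stay W j h `&` ev (j%:R * h) m).
have vE n : pr (P k) (shift 0 @^-1` window_stay W j h `&` ev (j.+1%:R * h) n) =
    \sum_(m <- W) p m n h * v m.
  have mE : measurable (shift 0 @^-1` window_stay W j h `&` ev (j.+1%:R * h) n).
    exact: measurableI.
  transitivity (pr (P k) (shift 0 @^-1` window_stay W j h `&` ev (j.+1%:R * h) n `&`
      [set w | X (j%:R * h) w \in W])).
    congr (pr _ _); apply/seteqP; split => w; last by case.
    by move=> [wW wn]; split => //; have := wW j (leqnn j); rewrite shifted_path0.
  rewrite -(pr_sum_at_state hX)//; apply: eq_bigr => m _.
  have := markov_past hX k m n (jh0 j) h0 (@window_stay_event _ W j _ h0).
  have -> : j%:R * h + h = j.+1%:R * h by rewrite -natr1 mulrDl mul1r.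
  rewrite [v m](_ : _ = pr (P k) (ev (j%:R * h) m `&` shift 0 @^-1` window_stay W j h)).
    move=> <-; congr (pr _ _).
    by rewrite [LHS]setIC setIA [RHS]setIC setIA [X in X `&` _]setIC.
  by rewrite /v setIC.
have hit_step : pr (P k) (shift 0 @^-1` window_hit W s j.+1 h) <=
    pr (P k) (shift 0 @^-1` window_hit W s j h) + \sum_(m <- W) p m s h * v m.
  rewrite -vE window_hitS preimage_setU.
  have -> : shift 0 @^-1` (window_stay W j h `&` [set x | x (j.+1%:R * h) = s]) =
      shift 0 @^-1` window_stay W j h `&` ev (j.+1%:R * h) s.
    by apply/seteqP; split => w [wW ws]; split => //; move: ws; rewrite /= shifted_path0.
  by apply: prU_le => //; exact: measurableI.
have stay_step n :
    pr (P k) (shift 0 @^-1` window_stay W j.+1 h `&` ev (j.+1%:R * h) n) <=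
    \sum_(m <- W) p m n h * v m.
  rewrite -vE; apply: pr_mono; [exact: measurableI..|].
  by rewrite window_stayS => w [[wW _] wn].
have {}IH := IH jt'.
have stay_sum : \sum_(n <- W)
    pr (P k) (shift 0 @^-1` window_stay W j.+1 h `&` ev (j.+1%:R * h) n) * u n s t'
    <= \sum_(n <- W) (\sum_(m <- W) p m n h * v m) * u n s t'.
  by apply: ler_sum => n _; rewrite ler_wpM2r// transformed_passage_ge0.
apply: le_trans (lerD hit_step stay_sum) _.
(* Exchanging the sums groups the terms by the state [m] at time [j%:R * h], where
   [transformed_passage_step] applies. *)
have -> : \sum_(n <- W) (\sum_(m <- W) p m n h * v m) * u n s t' =
    \sum_(m <- W) v m * \sum_(n <- W) p m n h * u n s t'.
  under eq_bigr do rewrite mulr_suml.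
  rewrite exchange_big /=; apply: eq_bigr => m _; rewrite mulr_sumr.
  by apply: eq_bigr => n _; ring.
rewrite -addrA -big_split /=.
apply: le_trans (_ : _ <= pr (P k) (shift 0 @^-1` window_hit W s j h) +
    (\sum_(m <- W) v m * u m s (t - j%:R * h) + \sum_(m <- W) transform_error W s m h)) _;
  last by rewrite addrA lerD2r.
rewrite lerD2l -big_split /=; apply: ler_sum => m _.
have -> : p m s h * v m + v m * (\sum_(n <- W) p m n h * u n s t') =
    v m * (p m s h + \sum_(n <- W) p m n h * u n s t') by ring.
have v0 : 0 <= v m by exact: pr_ge0.
have v1 : v m <= 1 by apply: pr_le1; exact: measurableI.
apply: le_trans (ler_wpM2l v0 (transformed_passage_step m uW h0 t'0)) _.
by rewrite mulrDr -tE lerD2l ler_piMl// transform_error_ge0.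
Qed.

Lemma transform_error_little_o W s :
  little_o (fun h => \sum_(m <- W) transform_error W s m h).
Proof.
apply: little_o_sum => m; apply: little_o_sum => n.
by apply: little_oM; [rewrite divr_ge0|exact: transition_transform].
Qed.

Lemma passage_prob_le_transform k s t : k <> s -> 0 < t ->
  passage_prob P X k s t <= u k s t.
Proof.
move=> ks t0; have mh := hit_measurable hX s t (lexx 0).
have m0 := at_state_measurable hX k (lexx 0).
rewrite /passage_prob (pr_I_init hX k mh).
pose g N : R := t / N.+1%:R.
have g0 N : 0 < g N by rewrite divr_gt0.
(* Adding the absolute value of [k] puts the starting state in every window. *)
pose W K := window s (K + `|k|%N).
apply: (@pr_liminf_le _ _ _ _ _
  (fun K N => shift 0 @^-1` window_hit (W K) s N (g N))).
- exact: measurableI.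
- move=> K N; have gN := ltW (g0 N).
  apply: (past_measurable hX _ (@window_hit_event _ (W K) s N _ gN)).
  by rewrite mulr_ge0.
- move=> K K' N KK' w; apply: window_hit_subset.
  by rewrite leq_add2r.
- move=> w [wh w0].
  have [K HK] := hit_grid_hit (shifted_path_right_continuous hX w (lexx 0)) wh.
  have [B HB] := shifted_path_bounded hX w t.
  exists (maxn K B) => // N /= KN.
  apply: window_hit_bounded.
  + by rewrite shifted_path0 /= w0.
  + by apply: HK; apply: leq_trans KN; rewrite leq_maxl.
  move=> i iN; apply: leq_trans (HB _ _) _; last by rewrite (leq_trans (leq_maxr K B)) ?leq_addr.
  have -> /= : 0 <= i%:R * g N by rewrite mulr_ge0// ltW.
  by rewrite /g mulrA ler_pdivrMr// mulrC ler_pM2l// ler_nat leqW.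
move=> K e e0.
have et0 : 0 < e / t by rewrite divr_gt0.
have [r r0 Hr] := transform_error_little_o (W K) s et0.
(* The window is fixed before [N] is chosen, so the mesh can be taken below the radius [r] belonging
   to that window. *)
pose N := maxn K (Num.truncn (t / r)).
exists N; first exact: leq_maxl.
have gr : g N < r.
  rewrite /g ltr_pdivrMr// mulrC -ltr_pdivrMr//.
  by apply: lt_le_trans (truncnS_gt _) _; rewrite ler_nat ltnS leq_maxr.
have Ngt : N%:R * g N < t by rewrite /g mulrA ltr_pdivrMr// mulrC ltr_pM2l// ltr_nat.
have uW : uniq (s :: W K) by rewrite /= mem_window eqxx window_uniq.
have kW : k \in W K by rewrite mem_window; apply/andP; split; [exact/eqP|rewrite leq_addl].
have := window_hit_le uW kW (ltW (g0 N)) Ngt.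
move=> H; apply: le_trans (_ : _ <= u k s t + N%:R * (e / t * g N)) _.
  apply: le_trans (le_trans _ H) _.
    rewrite lerDl; apply: sumr_ge0 => m _.
    by rewrite mulr_ge0 ?pr_ge0// transformed_passage_ge0.
  by rewrite lerD2l ler_wpM2l// Hr// g0.
(* The accumulated error is [e / t] times [N%:R * g N], which is less than [t]. *)
rewrite lerD2l mulrCA -[leRHS](divfK (lt0r_neq0 t0)).
by rewrite ler_wpM2l ?(ltW et0)// ltW.
Qed.

End comparison.

(** * Equality of passage probabilities and the crossing probabilities *)

Lemma passage_prob_transform (R : realType) (lambda mu nu : int -> R)
    (d : measure_display) (T : measurableType d)
    (P : int -> probability T R) (X : R -> T -> int)
    (d' : measure_display) (T' : measurableType d')
    (P' : int -> probability T' R) (X' : R -> T' -> int) :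
  bilateral_birth_death P X lambda mu ->
  (forall n, 0 < nu n) ->
  (forall n : int,
    nu (n + 1) * lambda n - nu n * (lambda n + mu n) + nu (n - 1) * mu n = 0) ->
  bilateral_birth_death P' X'
    (fun n : int => lambda n * (nu (n + 1) / nu n))
    (fun n : int => mu n * (nu (n - 1) / nu n)) ->
  forall k s t, k <> s ->
  passage_prob P' X' k s t = nu s / nu k * passage_prob P X k s t.
Proof.
move=> hX nu_gt0 hnu hX' k s t ks.
have nu_neq0 n : nu n != 0 by rewrite gt_eqF.
have [t0|t0] := leP t 0; first by rewrite !passage_prob0// mulr0.
(* Multiplied by [nu n], this is the harmonicity equation. *)
have exit_eq n : lambda n * (nu (n + 1) / nu n) + mu n * (nu (n - 1) / nu n) =
    lambda n + mu n.
  apply: (mulfI (nu_neq0 n)); apply/eqP; rewrite -subr_eq0; apply/eqP.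
  by rewrite -[RHS](hnu n); field.
have le1 : passage_prob P X k s t <= nu k / nu s * passage_prob P' X' k s t.
  apply: (passage_prob_le_transform hX hX') => // n.
  - by field.
  - by field.
(* [X] is in turn the transform of [X'] by the inverse of [nu], so the same inequality gives the
   reverse bound. *)
have le2 : passage_prob P' X' k s t <= (nu k)^-1 / (nu s)^-1 * passage_prob P X k s t.
  apply: (passage_prob_le_transform (nu := fun n => (nu n)^-1) hX' hX) => // n.
  - by rewrite invr_gt0.
  - by field; rewrite !nu_neq0.
  - by field; rewrite !nu_neq0.
apply/eqP; rewrite eq_le [nu s / nu k]mulrC -{1}[nu s]invrK le2/=.
by rewrite -ler_pdivlMl ?mulr_gt0 ?invr_gt0// invfM invrK.
Qed.

Theorem mainTheorem3 (R : realType) (lambda mu nu : int -> R)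
    (d : measure_display) (T : measurableType d)
    (P : int -> probability T R) (X : R -> T -> int)
    (d' : measure_display) (T' : measurableType d')
    (P' : int -> probability T' R) (X' : R -> T' -> int)
    (hX : bilateral_birth_death P X lambda mu)
    (hsimple : simple_rates lambda mu)
    (hnu_gt0 : forall n, 0 < nu n)
    (hnu_mono : (forall m n : int, m < n -> nu m < nu n) \/
                (forall m n : int, m < n -> nu n < nu m))
    (hnu : forall n : int,
      nu (n + 1) * lambda n - nu n * (lambda n + mu n) + nu (n - 1) * mu n = 0)
    (hX' : bilateral_birth_death P' X'
      (fun n : int => lambda n * (nu (n + 1) / nu n))
      (fun n : int => mu n * (nu (n - 1) / nu n))) :
  (forall k s : int, k <> s ->
    crossing_prob P' X' k s = ((nu s / nu k)%:E * crossing_prob P X k s)%E) /\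
  (forall k s : int, k <> s ->
    crossing_prob P X k s <> crossing_prob P' X' k s /\
    ~ (crossing_prob P X k s = 1%E /\ crossing_prob P' X' k s = 1%E)).
Proof.
have cross k s : k <> s ->
    crossing_prob P' X' k s = ((nu s / nu k)%:E * crossing_prob P X k s)%E.
  move=> ks; rewrite (crossing_probE hX ks) (crossing_probE hX' ks) -EFinM.
  (* Both crossing probabilities are limits at infinity, so the identity at each time passes to the
     limit. *)
  have cX' := passage_prob_cvgy hX' ks.
  have FE : passage_prob P' X' k s = (fun t => nu s / nu k * passage_prob P X k s t).
    by apply/funext => t; exact: (passage_prob_transform hX hnu_gt0 hnu hX').
  have cX : passage_prob P' X' k s t @[t --> +oo] -->
      nu s / nu k * sup (range (passage_prob P X k s)).
    by rewrite FE; apply: cvgMr; exact: (passage_prob_cvgy hX).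
  by congr EFin; exact: (cvg_unique _ cX' cX).
have ne k s : k <> s -> crossing_prob P X k s <> crossing_prob P' X' k s.
  (* Cancelling the positive crossing probability of [X] from a supposed equality forces
     [nu s = nu k], against strict monotonicity. *)
  move=> ks; rewrite cross// (crossing_probE hX ks) -EFinM => /(congr1 fine) /=.
  have l0 := sup_passage_prob_gt0 hX k s.
  rewrite -[X in X = _]mul1r => /(mulIf (lt0r_neq0 l0)) nusk.
  have : nu s = nu k by rewrite -[LHS](divfK (lt0r_neq0 (hnu_gt0 k))) -nusk mul1r.
  have [sk|ks'|sk] := ltgtP s k; last by move: ks; rewrite sk.
  - by case: hnu_mono => H /eqP; [rewrite lt_eqF ?H|rewrite gt_eqF ?H].
  - by case: hnu_mono => H /eqP; [rewrite gt_eqF ?H|rewrite lt_eqF ?H].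
split => [//|k s ks]; split; first exact: ne.
by move=> [c1 c'1]; apply: (ne k s ks); rewrite c1 c'1.
Qed.
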